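(* If $G$ is a $48$-edge-connected bipartite graph and $|E(G)|$ is divisible by $5$, then $G$ admits a decomposition into paths of length $5$.
   Context: Graphs are simple. A decomposition into paths of length $5$ is a partition of $E(G)$ into edge sets of subgraphs each isomorphic to the path with $5$ edges. *)

(* Defs.v *)
(* A simple graph on a finite vertex type T is a symmetric,
   irreflexive relation e : rel T. *)
From mathcomp Require Import all_boot.
Set Implicit Arguments. Unset Strict Implicit. Unset Printing Implicit Defensive.

Definition edges (T : finType) (e : rel T) : {set {set T}} :=
  [set [set u.1; u.2] | u : T * T & e u.1 u.2].

Definition bipartite (T : finType) (e : rel T) : Prop :=
  exists A : {set T}, forall x y, e x y -> (x \in A) != (y \in A).

Definition del_edges (T : finType) (e : rel T) (F : {set {set T}}) : rel T :=
  fun x y => e x y && ([set x; y] \notin F).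

Definition connected_graph (T : finType) (e : rel T) : Prop :=
  forall x y : T, connect e x y.

Definition edge_connected (k : nat) (T : finType) (e : rel T) : Prop :=
  forall F : {set {set T}}, F \subset edges e -> #|F| < k ->
    connected_graph (del_edges e F).

Definition is_path_edgeset (l : nat) (T : finType) (e : rel T)
    (B : {set {set T}}) : Prop :=
  exists (x : T) (p : seq T),
    [/\ size p = l, uniq (x :: p), path e x p &
        B = [set [set a.1; a.2] | a in zip (x :: p) p]].

Definition path_decomposition (l : nat) (T : finType) (e : rel T) : Prop :=
  exists P : {set {set {set T}}},
    partition P (edges e) /\ forall B, B \in P -> is_path_edgeset l e B.

(* Main.v *)
(** Let A be one side of the bipartition and orient every edge from A to the other side B. Numbering
    the edges of a path of length 5 from its end in A colours them 1, ..., 5. Conversely, a colouring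
    of E(G) comes from a decomposition if at each vertex of A the colours 2, 3 and the colours 4, 5
    are equally frequent, at each vertex of B the colours 1, 2 and the colours 3, 4 are, and none of
    these frequencies is 1: bijections between the paired colours glue the edges to walks, and
    exchanges at a vertex destroy the repeated vertices one after the other.

    Such a colouring is obtained from a partition of E(G) into C, Z and L, where each vertex a of A
    meets 4m(a) edges of C, m(a) >= 2 edges of Z and an even number of edges of L, each vertex of B
    meets an even number, at least 8, of edges of C and an even number of edges of L, and L is
    connected. Colour Z by 5. Splitting closed trails covering C alternately, twice, gives the
    colours 1, ..., 4 on C. The length of an Euler tour of L is divisible by 10, so L can be coloured
    periodically by 1, 2, 3, 4, 5, 5, 4, 3, 2, 1 along the tour.

    For the partition, Rado's theorem for a union of graphic matroids yields sparse disjoint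
    connected sets T0, U1, U2 with all degrees in U1 and U2 even. L contains T0, which makes it
    connected; one edge of each consecutive pair of an Euler tour of U1 goes to L and the other one
    to C, and those of U2 go to C and Z. A T-join in the tour of U1 makes the degrees of L in B
    even, and then one in the tour of U2 those of C. *)
Require Import Defs.
From mathcomp Require Import all_boot fingroup perm ssralg zmodp matrix mxalgebra rat zify.
Set Implicit Arguments. Unset Strict Implicit. Unset Printing Implicit Defensive.

(** * T-joins and closed trails *)

(** At a vertex of A the class sizes are prescribed exactly; at a vertex of B only parities and one
    lower bound matter. Exchanging two edges with the same end in A changes degrees in B alone, so
    the sizes at A are settled first and the parities at B repaired afterwards. U1 and U2 are
    reserves for these repairs: connectedness leaves one global parity condition for each, and it
    holds automatically because l(a) = d(a) - 5m(a) and 4m(a) are even. Z needs no repair, since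
    colour 5 is unconstrained at B.

    The constant 48: an edge outside a set joins at most two of its components, so at least 24 edges
    lie outside per component but one. Keeping one edge in two at each vertex of B gives 24 / 2 = 12
    disjoint connected sets and leaves 24 = 8 * 3 edges at b, enough to reserve 8 of them for C
    while using only one edge in three at A. The twelve sets split as 6 + 6, and 6 = 3 * 2 = 2 * 3
    permits a second thinning, at A, into three sets (T0 and the material of U1) and two sets (the
    material of U2). *)

Definition fib (X V : finType) (D : {set X}) (k : X -> V) (v : V) : {set X} :=
  [set x in D | k x == v].

Lemma in_fib (X V : finType) (D : {set X}) (k : X -> V) v x :
  (x \in fib D k v) = (x \in D) && (k x == v).
Proof. by rewrite inE. Qed.

Lemma card_fibs (X V : finType) (D : {set X}) (k : X -> V) :
  #|D| = \sum_v #|fib D k v|.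
Proof.
rewrite -sum1_card (partition_big k predT) //=.
apply: eq_bigr => v _; rewrite -sum1_card; apply: eq_bigl => x.
by rewrite in_fib.
Qed.

Lemma odd_card_addb (X : finType) (D : {set X}) :
  odd #|D| = \big[addb/false]_x (x \in D).
Proof.
rewrite -sum1_card big_mkcond /= (big_morph odd oddD (erefl _)).
by apply: eq_bigr => x _; case: (x \in D).
Qed.

Definition symdiff (X : finType) (A B : {set X}) : {set X} :=
  [set x | (x \in A) (+) (x \in B)].

Lemma odd_symdiff (X : finType) (A B : {set X}) :
  odd #|symdiff A B| = odd #|A| (+) odd #|B|.
Proof.
rewrite !odd_card_addb -big_split /=.
by apply: eq_bigr => x _; rewrite inE.
Qed.

Lemma fib_symdiff (X V : finType) (A B : {set X}) (k : X -> V) v :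
  fib (symdiff A B) k v = symdiff (fib A k v) (fib B k v).
Proof. by apply/setP => x; rewrite !inE; case: (k x == v); rewrite ?andbF ?andbT. Qed.

Lemma odd_fib_set1 (X V : finType) (k : X -> V) x v :
  odd #|fib [set x] k v| = (k x == v).
Proof.
have [<-|nk] := altP (k x =P v).
  by rewrite (_ : fib _ _ _ = [set x]) ?cards1 //; apply/setP => y; rewrite !inE; case: eqP => [->|]; rewrite ?eqxx.
rewrite (_ : fib _ _ _ = set0) ?cards0 //; apply/setP => y; rewrite !inE.
by case: eqP => [->|] //; rewrite (negPf nk).
Qed.

Lemma fib_set0 (X V : finType) (k : X -> V) v : fib set0 k v = set0.
Proof. by apply/setP => x; rewrite !inE. Qed.

(* An index i of P is an edge joining l i and r i. *)
Definition adjI (I V : finType) (P : {set I}) (l r : I -> V) : rel V :=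
  fun x y => [exists i in P, ((l i == x) && (r i == y)) || ((l i == y) && (r i == x))].

(** The parity of the degree in a multigraph: an index with [l i = r i] is a loop and cancels. Loops
    are allowed because the edges will later be segments of closed trails. *)
Definition odd_at (I V : finType) (P : {set I}) (l r : I -> V) (v : V) : bool :=
  odd #|fib P l v| (+) odd #|fib P r v|.

Lemma odd_at_set0 (I V : finType) (l r : I -> V) v : odd_at set0 l r v = false.
Proof. by rewrite /odd_at !fib_set0 cards0. Qed.

Lemma odd_at_symdiff (I V : finType) (P Q : {set I}) (l r : I -> V) v :
  odd_at (symdiff P Q) l r v = odd_at P l r v (+) odd_at Q l r v.
Proof. by rewrite /odd_at !fib_symdiff !odd_symdiff addbACA. Qed.

Lemma adjI_sym (I V : finType) (P : {set I}) (l r : I -> V) : symmetric (adjI P l r).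
Proof. by move=> x y; apply: eq_existsb => i; rewrite orbC. Qed.

Lemma connect_adjI_sym (I V : finType) (P : {set I}) (l r : I -> V) :
  connect_sym (adjI P l r).
Proof. by apply: sym_connect_sym; apply: adjI_sym. Qed.

(** The edges of a walk are summed modulo 2; repeated edges cancel, so the walk need not be a
    path. *)
Lemma Tjoin2 (I V : finType) (P : {set I}) (l r : I -> V) x y :
  connect (adjI P l r) x y ->
  exists2 J : {set I}, J \subset P & forall v, odd_at J l r v = (v == x) (+) (v == y).
Proof.
case/connectP => p; elim: p x => [|z p IHp] x /=.
  move=> _ ->; exists set0; first exact: sub0set.
  by move=> v; rewrite addbb odd_at_set0.
case/andP => /exists_inP[i iP ixz] pz ey.
have [J sJ Jodd] := IHp _ pz ey.
exists (symdiff J [set i]).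
  apply/subsetP => j; rewrite !inE; case: eqP => [-> //|_].
  by rewrite addbF; apply: (subsetP sJ).
move=> v; rewrite odd_at_symdiff Jodd /odd_at !odd_fib_set1.
rewrite ![_ == v]eq_sym.
by case/orP: ixz => /andP[/eqP<- /eqP<-]; case: (v == l i); case: (v == r i); case: (v == y).
Qed.

Lemma Tjoin (I V : finType) (P : {set I}) (l r : I -> V) (O : {set V}) :
  (forall x, ~~ odd #|[set y in O | connect (adjI P l r) x y]|) ->
  exists2 J : {set I}, J \subset P & forall v, odd_at J l r v = (v \in O).
Proof.
move: {2}#|O| (leqnn #|O|) => n; elim: n O => [|n IHn] O leO ev.
  move: leO; rewrite leqn0 cards_eq0 => /eqP->; exists set0; first exact: sub0set.
  by move=> v; rewrite odd_at_set0 inE.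
have [->|[x xO]] := set_0Vmem O.
  exists set0; first exact: sub0set.
  by move=> v; rewrite odd_at_set0 inE.
have [y]: exists y, y \in [set y in O | connect (adjI P l r) x y] :\ x.
  apply/set0Pn; apply: contra (ev x) => /eqP e0.
  by rewrite (cardsD1 x) e0 cards0 inE xO connect0.
rewrite !inE => /and3P[yx yO cxy].
have [J1 sJ1 J1o] := Tjoin2 cxy.
have sub2 : [set x; y] \subset O by apply/subsetP => z; rewrite !inE => /orP[]/eqP->.
have [||J2 sJ2 J2o] := IHn (O :\: [set x; y]).
- have := cardsID [set x; y] O; rewrite (setIidPr sub2) cards2 eq_sym yx /=.
  by move=> eqO; move: leO; rewrite -eqO addSn ltnS addSn add0n; apply: leq_trans; rewrite leqnSn.
- move=> z; set C := [set _ in _ | _].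
  have -> : C = symdiff [set w in O | connect (adjI P l r) z w]
                   (if connect (adjI P l r) z x then [set x; y] else set0).
    apply/setP => w; rewrite !inE.
    have same : connect (adjI P l r) z y = connect (adjI P l r) z x.
      by rewrite -(same_connect_r (@connect_adjI_sym _ _ P l r) cxy).
    have [->|wx] := eqVneq w x; last have [->|wy] := eqVneq w y;
      rewrite ?orbT ?orbF ?same;
      by case czx: (connect _ z x);
         rewrite !inE ?eqxx ?(negPf wx) ?(negPf wy) ?xO ?yO ?same ?czx ?orbT ?addbF ?andbF.
  by rewrite odd_symdiff (negPf (ev z)); case: ifP; rewrite ?cards0 // cards2 eq_sym yx.
exists (symdiff J1 J2).
  apply/subsetP => i; rewrite inE.
  case i1: (i \in J1); first by rewrite (subsetP sJ1).
  by apply: (subsetP sJ2).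
move=> v; rewrite odd_at_symdiff J1o J2o !inE.
case: eqP => [->|_]; first by rewrite xO eq_sym (negPf yx).
by case: eqP => [->|_].
Qed.

(** The transitions of closed trails at the vertices of one side; two pairings, one for each side,
    cut [D] into closed trails. Being the identity outside [D] makes [f] an involution of the whole
    type, hence injective. *)
Definition pairing (X V : finType) (D : {set X}) (k : X -> V) (f : X -> X) : Prop :=
  [/\ involutive f, forall x, x \notin D -> f x = x,
      forall x, x \in D -> f x \in D /\ f x != x & forall x, k (f x) = k x].

Lemma even_involution (X : finType) (K : {set X}) (f : X -> X) :
  involutive f -> (forall x, x \in K -> f x \in K /\ f x != x) -> ~~ odd #|K|.
Proof.
move=> ff; move: {2}#|K| (leqnn #|K|) => n; elim: n K => [|n IHn] K leK fK.
  by move: leK; rewrite leqn0 => /eqP->.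
have [->|[x xK]] := set_0Vmem K; first by rewrite cards0.
have [fxK fxx] := fK x xK.
have sub2 : [set x; f x] \subset K by apply/subsetP => z; rewrite !inE => /orP[]/eqP->.
have := cardsID [set x; f x] K; rewrite (setIidPr sub2) cards2 eq_sym fxx /= => eqK.
rewrite -eqK oddD /= IHn //.
  by move: leK; rewrite -eqK addSn ltnS addSn add0n; apply: leq_trans; rewrite leqnSn.
move=> y; rewrite !inE negb_or -andbA => /and3P[yx yfx yK].
have [fyK fyy] := fK y yK; split => //.
rewrite fyK andbT (inj_eq (inv_inj ff)) (negPf yx) orbF.
by apply: contra yfx => /eqP<-; rewrite ff.
Qed.

Lemma pairing_exists (X V : finType) (D : {set X}) (k : X -> V) :
  (forall v, ~~ odd #|fib D k v|) -> exists f : {ffun X -> X}, pairing D k f.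
Proof.
move: {2}#|D| (leqnn #|D|) => n; elim: n D => [|n IHn] D leD ev.
  move: leD; rewrite leqn0 cards_eq0 => /eqP->.
  by exists [ffun x => x]; split => [x|x|x|x]; rewrite ?ffunE // inE.
have [->|[x xD]] := set_0Vmem D.
  by exists [ffun x => x]; split => [x|x|x|x]; rewrite ?ffunE // inE.
have [y]: exists y, y \in fib D k (k x) :\ x.
  apply/set0Pn; apply: contra (ev (k x)) => /eqP e0.
  by rewrite (cardsD1 x) e0 cards0 inE xD eqxx.
rewrite !inE => /and3P[yx yD /eqP kyx].
have sub2 : [set x; y] \subset D by apply/subsetP => z; rewrite !inE => /orP[]/eqP->.
have cD := cardsID [set x; y] D; rewrite (setIidPr sub2) cards2 eq_sym yx /= in cD.
have [||f [ff f0 fD kf]] := IHn (D :\: [set x; y]).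
- by move: leD; rewrite -cD addSn ltnS addSn add0n; apply: leq_trans; rewrite leqnSn.
- move=> v; have -> : fib (D :\: [set x; y]) k v =
     symdiff (fib D k v) (if k x == v then [set x; y] else set0).
    apply/setP => w.
    have [->|wx] := eqVneq w x; last have [->|wy] := eqVneq w y;
      by case kxv: (k x == v);
         rewrite !inE ?eqxx ?(negPf wx) ?(negPf wy) ?xD ?yD ?kyx ?kxv ?orbT ?addbF ?andbF.
  by rewrite odd_symdiff (negPf (ev v)); case: ifP => _; rewrite ?cards0 // cards2 eq_sym yx.
have fx : f x = x by apply: f0; rewrite !inE eqxx.
have fy : f y = y by apply: f0; rewrite !inE eqxx orbT.
pose g := [ffun z => if z == x then y else if z == y then x else f z].
have fne z w : f w = w -> z != w -> f z != w.
  by move=> fw; apply: contra => /eqP e; rewrite -(inj_eq (inv_inj ff)) e fw.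
exists g; split.
- move=> z; rewrite !ffunE; case: (altP (z =P x)) => [->|zx]; first by rewrite eqxx (negPf yx).
  case: (altP (z =P y)) => [->|zy]; first by rewrite eqxx.
  by rewrite (negPf (fne _ _ fx zx)) (negPf (fne _ _ fy zy)) ff.
- move=> z zD; rewrite ffunE; case: eqP => [zx|_]; first by rewrite zx xD in zD.
  case: eqP => [zy|_]; first by rewrite zy yD in zD.
  by apply: f0; rewrite inE (negPf zD) andbF.
- move=> z zD; rewrite ffunE; case: (altP (z =P x)) => [->|zx] //.
  case: (altP (z =P y)) => [->|zy]; first by rewrite eq_sym.
  have [|] := fD z; first by rewrite !inE negb_or zx zy.
  by rewrite inE => /andP[].
- by move=> z; rewrite ffunE; case: eqP => [->|_] //; case: eqP => [->|].
Qed.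

Definition step2 (X : finType) (f g : X -> X) : rel X :=
  fun x y => (y == f x) || (y == g x).

Lemma step2_sym (X : finType) (f g : X -> X) :
  involutive f -> involutive g -> symmetric (step2 f g).
Proof.
move=> ff gg; have key (h : X -> X) x y : involutive h -> (y == h x) = (x == h y).
  by move=> hh; rewrite -(inj_eq (inv_inj hh)) hh eq_sym.
by move=> x y; rewrite /step2 (key f x y ff) (key g x y gg).
Qed.

Lemma connect_step2_sym (X : finType) (f g : X -> X) :
  involutive f -> involutive g -> connect_sym (step2 f g).
Proof. by move=> ff gg; apply: sym_connect_sym; apply: step2_sym. Qed.

Lemma connect_step2_l (X : finType) (f g : X -> X) x : connect (step2 f g) x (f x).
Proof. by apply: connect1; rewrite /step2 eqxx. Qed.

Lemma connect_step2_r (X : finType) (f g : X -> X) x : connect (step2 f g) x (g x).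
Proof. by apply: connect1; rewrite /step2 eqxx orbT. Qed.

Lemma step2C (X : finType) (f g : X -> X) : step2 f g =2 step2 g f.
Proof. by move=> x y; rewrite /step2 orbC. Qed.

Lemma connect_mono (X : finType) (e e' : rel X) :
  (forall x y, e x y -> connect e' x y) -> forall x y, connect e x y -> connect e' x y.
Proof. by move=> sub; apply: connect_sub => x y exy; apply: sub. Qed.

Lemma pairing_closed (X V W : finType) (D : {set X}) (k1 : X -> V) (k2 : X -> W) f g x y :
  pairing D k1 f -> pairing D k2 g -> connect (step2 f g) x y -> (y \in D) = (x \in D).
Proof.
move=> [ff f0 fD _] [gg g0 gD _] /connectP[p]; elim: p x => [|z p IHp] x /= => [_ -> //|].
case/andP => xz pz ey; rewrite (IHp z pz ey).
have inv h : (forall x, x \notin D -> h x = x) -> (forall x, x \in D -> h x \in D /\ h x != x) ->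
  (h x \in D) = (x \in D).
  move=> h0 hD; have [xD|xD] := boolP (x \in D); first by have [->] := hD x xD.
  by rewrite h0 // (negPf xD).
by case/orP: xz => /eqP->; apply: inv.
Qed.

(* Re-pairing two elements with equal key that lie on different closed walks
   merges the walks: otherwise the pairing would split a part of one walk minus
   one element into pairs while the other pairing splits the whole part. *)
Lemma pairing_merge (X V W : finType) (D : {set X}) (k1 : X -> V) (k2 : X -> W)
    (f g : {ffun X -> X}) x y :
  pairing D k1 f -> pairing D k2 g -> x \in D -> y \in D -> k1 x = k1 y ->
  ~~ connect (step2 f g) x y ->
  exists f' : {ffun X -> X}, [/\ pairing D k1 f',
    forall u v, connect (step2 f g) u v -> connect (step2 f' g) u v &
    connect (step2 f' g) x y].
Proof.
move=> pf pg xD yD kxy nxy; have [ff f0 fD kf] := pf; have [gg g0 gD kg] := pg.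
have finj := inv_inj ff.
have fxy : f x != y.
  by apply: contra nxy => /eqP<-; apply: connect_step2_l.
have xy : x != y by apply: contra nxy => /eqP->; apply: connect0.
have fyx : f y != x by apply: contra fxy => /eqP<-; rewrite ff.
pose f' := [ffun z => if z == x then y else if z == y then x else
                      if z == f x then f y else if z == f y then f x else f z].
have [fxD fxx] := fD x xD; have [fyD fyy] := fD y yD.
have f'x : f' x = y by rewrite ffunE eqxx.
have f'y : f' y = x by rewrite ffunE eq_sym (negPf xy) eqxx.
have f'fx : f' (f x) = f y by rewrite ffunE (negPf fxx) (negPf fxy) eqxx.
have f'fy : f' (f y) = f x.
  by rewrite ffunE (negPf fyx) (negPf fyy) (inj_eq finj) eq_sym (negPf xy) eqxx.
have f'o z : z != x -> z != y -> z != f x -> z != f y -> f' z = f z.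
  by move=> h1 h2 h3 h4; rewrite ffunE (negPf h1) (negPf h2) (negPf h3) (negPf h4).
have pf' : pairing D k1 f'.
  have split4 (P : X -> Prop) : P x -> P y -> P (f x) -> P (f y) ->
     (forall z, z != x -> z != y -> z != f x -> z != f y -> P z) -> forall z, P z.
    move=> Px Py Pfx Pfy Po z.
    have [->//|zx] := eqVneq z x; have [->//|zy] := eqVneq z y.
    by have [->//|zfx] := eqVneq z (f x); have [->//|zfy] := eqVneq z (f y); apply: Po.
  split.
  - apply: split4; rewrite ?f'x ?f'y ?f'fx ?f'fy // => z zx zy zfx zfy.
    rewrite (f'o z) // f'o ?ff //.
    + by apply: contra zfx => /eqP<-; rewrite ff.
    + by apply: contra zfy => /eqP<-; rewrite ff.
    + by rewrite (inj_eq finj).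
    + by rewrite (inj_eq finj).
  - by apply: split4; rewrite ?xD ?yD ?fxD ?fyD // => z *; rewrite f'o // f0.
  - apply: split4; rewrite ?f'x ?f'y ?f'fx ?f'fy ?(inj_eq finj) ?(eq_sym y x) ?xy //.
    by move=> z zx zy zfx zfy zD; rewrite f'o //; apply: fD.
  - by apply: split4; rewrite ?f'x ?f'y ?f'fx ?f'fy ?kf // => z *; rewrite f'o ?kf.
have [ff' _ f'D _] := pf'.
have c'xy : connect (step2 f' g) x y by rewrite -f'x; apply: connect_step2_l.
have csym' := connect_step2_sym ff' gg.
have csym := connect_step2_sym ff gg.
have c'xfx : connect (step2 f' g) x (f x).
  apply: contraT => nc.
  pose K := [set z | connect (step2 f' g) x z && connect (step2 f g) x z].
  have xK : x \in K by rewrite inE !connect0.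
  have K_D z : z \in K -> z \in D.
    by rewrite inE => /andP[_ c]; rewrite (pairing_closed pf pg c).
  have evK : ~~ odd #|K|.
    apply: (even_involution gg) => z zK; have [_ gzz] := gD z (K_D z zK); split => //.
    move: zK; rewrite !inE => /andP[c1 c2].
    by rewrite (connect_trans c1 (connect_step2_r _ _ _)) (connect_trans c2 (connect_step2_r _ _ _)).
  have evK1 : ~~ odd #|K :\ x|.
    apply: (even_involution ff) => z; rewrite !inE => /and3P[zx c1 c2].
    have zy : z != y by apply: contra nxy => /eqP<-.
    have zfx : z != f x by apply: contra nc => /eqP<-.
    have zfy : z != f y.
      apply: contra nxy => /eqP ez; rewrite ez in c2.
      by apply: (connect_trans c2); rewrite csym; apply: connect_step2_l.
    have zD : z \in D by rewrite (pairing_closed pf pg c2).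
    have [_ fzz] := fD z zD; split => //.
    have fzx : f z != x by apply: contra zfx => /eqP<-; rewrite ff.
    rewrite fzx (connect_trans c2 (connect_step2_l _ _ _)) andbT /=.
    by apply: (connect_trans c1); rewrite -(f'o z) //; apply: connect_step2_l.
  by move: evK; rewrite (cardsD1 x) xK add1n /= evK1.
have c'yfy : connect (step2 f' g) y (f y).
  apply: (@connect_trans _ _ x); first by rewrite csym'.
  by apply: (connect_trans c'xfx); rewrite -f'fx; apply: connect_step2_l.
exists f'; split => //; apply: connect_mono => u v /orP[]/eqP->; last exact: connect_step2_r.
have [->//|ux] := eqVneq u x; have [->//|uy] := eqVneq u y.
have [->|ufx] := eqVneq u (f x); first by rewrite ff csym'.
have [->|ufy] := eqVneq u (f y); first by rewrite ff csym'.
by rewrite -f'o //; apply: connect_step2_l.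
Qed.

(* Two families of transitions for which the closed walks are the connected
   components: maximise the number of elements joined by a walk. *)
Lemma transitions_exist (X V W : finType) (D : {set X}) (k1 : X -> V) (k2 : X -> W) :
  (forall v, ~~ odd #|fib D k1 v|) -> (forall v, ~~ odd #|fib D k2 v|) ->
  exists f g : X -> X, [/\ pairing D k1 f, pairing D k2 g &
    forall x y, x \in D -> y \in D -> k1 x = k1 y \/ k2 x = k2 y ->
      connect (step2 f g) x y].
Proof.
move=> ev1 ev2.
have [f0 pf0] := pairing_exists ev1; have [g0 pg0] := pairing_exists ev2.
pose mu (f g : X -> X) := #|[set p : X * X | connect (step2 f g) p.1 p.2]|.
have mu_lt f g f' g' x y : (forall u v, connect (step2 f g) u v -> connect (step2 f' g') u v) ->
  connect (step2 f' g') x y -> ~~ connect (step2 f g) x y -> mu f g < mu f' g'.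
  move=> sub c' nc; apply: proper_card; apply/properP; split.
    by apply/subsetP => p; rewrite !inE; apply: sub.
  by exists (x, y); rewrite inE.
suff ex m : forall f g : {ffun X -> X}, pairing D k1 f -> pairing D k2 g ->
  #|{: X * X}| - mu f g <= m ->
  exists f g : X -> X, [/\ pairing D k1 f, pairing D k2 g &
    forall x y, x \in D -> y \in D -> k1 x = k1 y \/ k2 x = k2 y ->
      connect (step2 f g) x y] by apply: (ex _ f0 g0 pf0 pg0 (leqnn _)).
elim: m => [|m IHm] f g pf pg lem.
  exists f, g; split => // x y _ _ _; apply: contraT => nc.
  have : mu f g < #|{: X * X}|.
    by rewrite -cardsT; apply: proper_card; apply/properP; split; [apply: subsetT|exists (x, y); rewrite inE].
  by rewrite ltnNge -subn_eq0 -leqn0 lem.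
have [/existsP[x /existsP[y /and4P[xD yD nc kk]]]|none] := boolP [exists x, exists y,
   [&& x \in D, y \in D, ~~ connect (step2 f g) x y & (k1 x == k1 y) || (k2 x == k2 y)]]; last first.
  exists f, g; split => // x y xD yD kk; apply: contraT => nc; case/existsP: none.
  exists x; apply/existsP; exists y; rewrite xD yD nc /=.
  by case: kk => ->; rewrite eqxx ?orbT.
have dec f' g' : mu f g < mu f' g' -> #|{: X * X}| - mu f' g' <= m.
  move=> lt; rewrite -ltnS; apply: leq_trans lem; apply: ltn_sub2l => //.
  by apply: leq_trans lt _; apply: max_card.
case/orP: kk => /eqP kk.
  have [f' [pf' sub c']] := pairing_merge pf pg xD yD kk nc.
  by apply: (IHm f' g) => //; apply: dec; apply: mu_lt sub c' nc.
have swap (h h' : X -> X) u v : connect (step2 h h') u v = connect (step2 h' h) u v.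
  by apply: eq_connect; apply: step2C.
rewrite swap in nc.
have [g' [pg' sub c']] := pairing_merge pg pf xD yD kk nc.
apply: (IHm f g') => //; apply: dec; apply: (mu_lt _ _ _ _ x y).
- by move=> u v c; rewrite swap; apply: sub; rewrite swap.
- by rewrite swap.
- by rewrite swap.
Qed.

(** If [f x] were reached from [x], the segment between them would be its own reversal; shortening
    it at both ends leads to a fixed point of [f] or of [g] in [D]. *)
Lemma iter_walk_neq (X V W : finType) (D : {set X}) (k1 : X -> V) (k2 : X -> W) f g i x :
  pairing D k1 f -> pairing D k2 g -> x \in D -> iter i (g \o f) x != f x.
Proof.
move=> [ff _ fD _] [gg _ gD _].
elim/ltn_ind: i x => -[|[|i]] IHi x xD.
- by have [_] := fD x xD; rewrite eq_sym.
- by have [fxD _] := fD x xD; have [_] := gD _ fxD.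
have [fxD _] := fD x xD; have [yD _] := gD _ fxD.
have := IHi i (leqnSn _) (g (f x)) yD; apply: contra => /eqP e.
rewrite -(inj_eq (inv_inj ff)) ff -(inj_eq (inv_inj gg)) gg.
by move: e; rewrite iterS iterSr /= => ->.
Qed.

Lemma walk_inj (X V W : finType) (D : {set X}) (k1 : X -> V) (k2 : X -> W) f g :
  pairing D k1 f -> pairing D k2 g -> injective (g \o f).
Proof. by move=> [ff _ _ _] [gg _ _ _]; apply: inj_comp; apply: inv_inj. Qed.

Lemma notin_walk (X V W : finType) (D : {set X}) (k1 : X -> V) (k2 : X -> W) f g x :
  pairing D k1 f -> pairing D k2 g -> x \in D -> ~~ fconnect (g \o f) x (f x).
Proof.
move=> pf pg xD; apply/negP => /iter_findex e.
by have := iter_walk_neq (findex (g \o f) x (f x)) pf pg xD; rewrite e eqxx.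
Qed.

(** A closed trail consists of two orbits of [g \o f], its even and its odd positions, which [f] and
    [g] exchange. They are distinct by [notin_walk], and comparing the ranks of their roots selects
    one of them. *)
Lemma bicolor (X V W : finType) (D : {set X}) (k1 : X -> V) (k2 : X -> W) f g :
  pairing D k1 f -> pairing D k2 g ->
  exists c : X -> bool, forall x, x \in D -> c (f x) = ~~ c x /\ c (g x) = ~~ c x.
Proof.
move=> pf pg; have [ff _ fD _] := pf; have [gg _ gD _] := pg.
have inj := walk_inj pf pg.
pose rt x := enum_rank (froot (g \o f) x).
have csym := fconnect_sym inj.
have rtP x y : fconnect (g \o f) x y -> rt x = rt y.
  by move=> c; rewrite /rt; congr enum_rank; apply/(rootP csym).
have rt1 x : rt (g (f x)) = rt x.
  by apply/esym/rtP; apply: connect1; apply/eqP.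
have rtN x : x \in D -> rt x != rt (f x).
  move=> xD; apply: contra (notin_walk pf pg xD).
  by rewrite (inj_eq enum_rank_inj) (root_connect csym).
have gE x : rt (g x) = rt (f x) by rewrite -(rt1 (f x)) ff.
have fgE x : rt (f (g x)) = rt x by rewrite -(rt1 (f (g x))) ff gg.
exists (fun x => rt x < rt (f x)) => x xD.
have lt : (rt (f x) < rt x) = ~~ (rt x < rt (f x)).
  by rewrite -leqNgt [LHS]ltn_neqAle [_ == _](_ : _ = false) // eq_sym; apply: negPf (rtN x xD).
by rewrite ff gE fgE.
Qed.

(* Transitions of colours inside a path coloured 1,2,3,4,5 from its end in A. *)
Definition swA (c : nat) : nat := nth 0 [:: 0; 1; 3; 2; 5; 4] c.
Definition swB (c : nat) : nat := nth 0 [:: 0; 2; 1; 4; 3; 5] c.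

(* A closed walk of length divisible by 10 is coloured 1,2,3,4,5,5,4,3,2,1
   periodically; colE and colO are the colours at the even and odd positions
   of that pattern, shifted so that positions 2i and 2i+1 meet in A. *)
Lemma tour_coloring (X V W : finType) (D : {set X}) (k1 : X -> V) (k2 : X -> W) f g :
  pairing D k1 f -> pairing D k2 g ->
  (forall x y, x \in D -> y \in D -> connect (step2 f g) x y) ->
  10 %| #|D| ->
  exists c : X -> nat, forall x, x \in D ->
    [/\ 0 < c x <= 5, c (f x) = swA (c x) & c (g x) = swB (c x)].
Proof.
move=> pf pg conn d10; have [ff f0 fD _] := pf; have [gg g0 gD _] := pg.
have inj := walk_inj pf pg.
have [->|[x0 x0D]] := set_0Vmem D; first by exists (fun=> 0) => x; rewrite inE.
pose s := fingraph.order (g \o f) x0; pose O := orbit (g \o f) x0.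
have csym := fconnect_sym inj.
have OD x : x \in O -> x \in D.
  rewrite -fconnect_orbit => /connectP[p]; elim/last_ind: p x => [|p y IHp] x /=.
    by move=> _ ->.
  rewrite rcons_path last_rcons => /andP[pp /eqP <-] ->.
  have lD := IHp _ pp erefl.
  by have [fl _] := fD _ lD; have [] := gD _ fl.
have O_step x : (g (f x) \in O) = (x \in O).
  rewrite -!fconnect_orbit; apply/esym/(same_connect_r csym).
  by apply: connect1; apply/eqP.
have O_f x : x \in D -> x \in O -> f x \notin O.
  move=> xD; rewrite -!fconnect_orbit => xO; apply: contra (notin_walk pf pg xD) => fxO.
  by rewrite -(same_connect csym xO).
have O_or x : x \in D -> (x \in O) || (f x \in O).
  move=> xD; have /connectP[p] := conn x0 x x0D xD.
  elim/last_ind: p x {xD} => [|p y IHp] x /=.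
    by move=> _ ->; rewrite -fconnect_orbit connect0.
  rewrite rcons_path last_rcons => /andP[pp lz] ->.
  have := IHp _ pp erefl; move: (last x0 p) lz => z /orP[]/eqP-> //; first by rewrite ff orbC.
  case/orP => zO; last by rewrite -(O_step (f z)) ff in zO; rewrite zO.
  by rewrite -(O_step (f (g z))) ff gg zO orbT.
have O_fE x : x \in D -> (f x \in O) = (x \notin O).
  move=> xD; have := O_or x xD; have := O_f x xD.
  by case: (x \in O) => // H; rewrite (negPf (H isT)).
have cardD : #|D| = s.*2.
  have cO : #|[set x in O]| = s by rewrite cardsE (card_uniqP (orbit_uniq _ _)) size_orbit.
  rewrite -(cardsID [set x in O] D) -addnn; congr (_ + _).
    by rewrite -cO; apply: eq_card => x; rewrite !inE andb_idl // => /OD.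
  rewrite -cO -(card_imset _ (inv_inj ff)); apply: eq_card => x; rewrite !inE.
  apply/imsetP/idP => [[y]|xO].
    by rewrite !inE => /andP[yO yD] ->; rewrite O_fE.
  have [fxD _] := fD x (OD _ xO); exists (f x); last by rewrite ff.
  by rewrite !inE fxD (O_f _ (OD _ xO) xO).
have d5 : 5 %| s by move: d10; rewrite cardD -muln2 -[10]/(5 * 2) dvdn_pmul2r.
(* The orbit holds every second edge of the tour, where the pattern has period 5. At the end of the
   orbit the index falls back to 0, consistently because 5 divides [s]. *)
pose r x := findex (g \o f) x0 x %% 5.
have r_step x : x \in O -> r (g (f x)) = (r x).+1 %% 5.
  rewrite -fconnect_orbit => xO; rewrite /r; set i := findex _ x0 x.
  have lti : i < s by apply: findex_max.
  have ex : iter i (g \o f) x0 = x by apply: iter_findex.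
  have -> : g (f x) = iter i.+1 (g \o f) x0 by rewrite iterS ex.
  have [lt|ge] := ltnP i.+1 s; first by rewrite findex_iter // -(addn1 (i %% 5)) modnDml addn1.
  have es : i.+1 = s by apply/eqP; rewrite eqn_leq lti ge.
  rewrite es (iter_order inj) findex0 mod0n -(addn1 (i %% 5)) modnDml addn1 es.
  by apply/esym/eqP.
pose colE i := nth 0 [:: 1; 2; 4; 5; 3] i; pose colO i := nth 0 [:: 1; 3; 5; 4; 2] i.
have swE i : i < 5 -> [/\ 0 < colE i <= 5, 0 < colO i <= 5, swA (colE i) = colO i,
    swA (colO i) = colE i & swB (colO i) = colE (i.+1 %% 5) /\ swB (colE (i.+1 %% 5)) = colO i].
  by do 5?[case: i => [|i] //].
pose c x := if x \in O then colE (r x) else colO (r (f x)).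
have r5 x : r x < 5 by rewrite ltn_mod.
have key x : x \in O -> [/\ c x = colE (r x), c (f x) = colO (r x) & c (g (f x)) = colE ((r x).+1 %% 5)].
  move=> xO; rewrite /c xO (negPf (O_f _ (OD _ xO) xO)) ff O_step xO.
  by rewrite r_step.
exists c => x xD.
have gx_in y : y \in O -> exists2 z, z \in O & y = g (f z).
  by move=> yO; exists (f (g y)); rewrite ?ff ?gg // -O_step ff gg.
have [xO|xO] := boolP (x \in O).
  have [-> -> _] := key x xO; have [r1 r2 r3 r4 _] := swE _ (r5 x).
  split => //; have [z zO ez] := gx_in x xO.
  have [_ cfz cgz] := key z zO; have [_ _ _ _ [_ r6]] := swE _ (r5 z).
  have [cx _ _] := key x xO.
  by rewrite -cx ez gg cfz cgz r6.
have fxO : f x \in O by rewrite O_fE.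
have [cfx cx cgx] := key _ fxO; rewrite ff in cx cgx.
have [r1 r2 r3 r4 [r6 _]] := swE _ (r5 (f x)).
by rewrite cfx cx cgx; split.
Qed.

(** * Paths from a colouring *)

(* If l f is the same vertex a for all f with o f = b, an edge joining a and b cannot be
   prepended at b to any of these f without repeating a. *)
Definition viol (F O L : finType) (o : F -> O) (l : F -> L) : {set O} :=
  [set b | [exists f, o f == b] &&
     [forall f, forall f', (o f == b) && (o f' == b) ==> (l f == l f')]].

Lemma violP (F O L : finType) (o : F -> O) (l : F -> L) b :
  reflect ((exists f, o f = b) /\ forall f f', o f = b -> o f' = b -> l f = l f')
          (b \in viol o l).
Proof.
rewrite inE; apply: (iffP andP) => [[/existsP[f /eqP fb] /forallP H]|[[f fb] H]].
  split; first by exists f.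
  by move=> f1 f2 e1 e2; have /forallP/(_ f2)/implyP := H f1; rewrite e1 e2 !eqxx => /(_ isT)/eqP.
split; first by apply/existsP; exists f; apply/eqP.
by apply/forallP => f1; apply/forallP => f2; apply/implyP => /andP[/eqP e1 /eqP e2]; apply/eqP/H.
Qed.

Definition fiber2 (F K : finType) (k : F -> K) : Prop :=
  forall f, exists2 f', f' != f & k f' = k f.

(** An edge is determined by its two ends; this is how simplicity of the graph enters the
    exchanges. *)
Definition sepby (F K L : finType) (k : F -> K) (l : F -> L) : Prop :=
  forall f f', k f = k f' -> l f = l f' -> f = f'.

(** After the exchange [o f0] sees the new label at [f0] and the old one at a second element [f2],
    so only [o f1] can become violated. Conversely, the old label is now seen from both [o f1] and
    [o f0], and a violation at the new label would give another of its elements the value [o f0],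
    where all labels were old. *)
Lemma swap_viol (F Q O L : finType) (q : F -> Q) (o : F -> O) (l : F -> L) f0 f1 :
  sepby q l -> fiber2 o -> fiber2 l -> o f0 \in viol o l ->
  q f0 = q f1 -> f0 != f1 ->
  let l1 := l \o tperm f0 f1 in
  [/\ o f1 != o f0, l f1 != l f0,
      viol o l1 \subset o f1 |: (viol o l :\ o f0) &
      viol l1 o \subset viol l o].
Proof.
move=> sep o2 l2 /violP[_ v0] qq ne l1.
have lne : l f1 != l f0.
  by apply: contra ne => /eqP e; apply/eqP/sep.
have one : o f1 != o f0.
  by apply: contra lne => /eqP e; apply/eqP; apply: v0.
have l10 : l1 f0 = l f1 by rewrite /l1 /= tpermL.
have l11 : l1 f1 = l f0 by rewrite /l1 /= tpermR.
have l1o f : f != f0 -> f != f1 -> l1 f = l f.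
  by move=> h0 h1; rewrite /l1 /= tpermD // eq_sym.
have [f2 f20 of2] := o2 f0.
have f21 : f2 != f1 by apply: contra one => /eqP <-; apply/eqP.
have lf2 : l1 f2 = l f0 by rewrite l1o //; apply: v0.
split => //.
  apply/subsetP => b /violP[[f fb] vb]; rewrite !inE.
  have [//|b1] := eqVneq b (o f1).
  have b0 : b != o f0.
    by apply: contra lne => /eqP eb; rewrite -l10 -lf2; apply/eqP/vb; rewrite ?eb.
  rewrite b0 /=; apply/andP; split; first by apply/existsP; exists f; apply/eqP.
  apply/forallP => g; apply/forallP => g'; apply/implyP => /andP[/eqP eg /eqP eg'].
  have dif h : o h = b -> l1 h = l h.
    by move=> e; apply: l1o; [apply: contra b0|apply: contra b1] => /eqP <-; rewrite e.
  by rewrite -(dif _ eg) -(dif _ eg'); apply/eqP/vb.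
apply/subsetP => a /violP[[f fa] va].
have ax : a != l f0.
  by apply: contra one => /eqP ea; rewrite -of2; apply/eqP/va; rewrite ?l11 ?lf2.
have ax' : a != l f1.
  apply/negP => /eqP ea.
  have [g g1 lg] := l2 f1.
  have g0 : g != f0 by apply: contra lne => /eqP <-; rewrite lg.
  have : o g = o f0 by apply: va; [rewrite l1o // lg ea | rewrite l10 ea].
  by move/v0/(_ (erefl _)) => e; move: lne; rewrite -lg e eqxx.
have dif h : l1 h = a -> l h = a.
  move=> e; rewrite -l1o //; first by apply: contra ax' => /eqP eh; rewrite -e eh l10.
  by apply: contra ax => /eqP eh; rewrite -e eh l11.
have dif' h : l h = a -> l1 h = a.
  move=> e; rewrite l1o //; first by apply: contra ax => /eqP eh; rewrite -e eh.
  by apply: contra ax' => /eqP eh; rewrite -e eh.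
apply/violP; split; first by exists f; apply: dif.
by move=> g g' /dif' eg /dif' eg'; apply: va.
Qed.

Lemma sepby_perm (F K L : finType) (k : F -> K) (l : F -> L) (s : {perm F}) :
  (forall f, k (s f) = k f) -> sepby k l -> sepby k (l \o s).
Proof. by move=> ks sep f f' kf lf; apply: (@perm_inj _ s); apply: sep => //; rewrite !ks. Qed.

Lemma fiber2_perm (F L : finType) (l : F -> L) (s : {perm F}) :
  fiber2 l -> fiber2 (l \o s).
Proof.
move=> l2 f; have [g gf lg] := l2 (s f); exists (s^-1%g g); last by rewrite /= permKV.
by apply: contra gf => /eqP <-; rewrite permKV.
Qed.

(** Each exchange either lowers the count or pushes the violation one vertex along the path. It
    cannot survive at the last vertex: the exchange turns at most one of the two elements there into
    one labelled [x]. *)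
Lemma improve_along_path (F Q O L : finType) (q : F -> Q) (o : F -> O) (l : F -> L) x b p :
  let e (l' : F -> L) u v := [exists f, exists f',
    [&& o f == u, l' f == x, q f == q f', f != f' & o f' == v]] in
  sepby q l -> fiber2 o -> fiber2 l ->
  (exists f, o f = b) -> (forall f, o f = b -> l f = x) ->
  path (e l) b p -> uniq (b :: p) ->
  (exists f f', [/\ f != f', o f = last b p, o f' = last b p, l f != x & l f' != x]) ->
  exists s : {perm F}, (forall f, q (s f) = q f) /\
    #|viol o (l \o s)| + #|viol (l \o s) o| < #|viol o l| + #|viol l o|.
Proof.
move=> e; elim: p l b => [|b1 p IHp] l b sep o2 l2 [f fb] vb.
  by move=> _ _ [f1 [f2 [_ e1 _ ]]]; rewrite vb ?eqxx.
rewrite [path _ _ _]/= [uniq _]/= inE negb_or.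
case/andP => /existsP[f0 /existsP[f1 /and5P[/eqP f0b /eqP f0x /eqP qq ne /eqP of1]]] pp.
case/andP => /andP[bb1 bp] /andP[b1p up] two.
have v0 : o f0 \in viol o l.
  apply/violP; split; first by exists f0.
  by move=> g g'; rewrite f0b => /vb-> /vb->.
have [one lne sub1 sub2] := swap_viol sep o2 l2 v0 qq ne.
set l1 := l \o tperm f0 f1 in sub1 sub2.
have qt f2 : q (tperm f0 f1 f2) = q f2 by case: tpermP => // ->.
have le2 : #|viol l1 o| <= #|viol l o| by apply: subset_leq_card.
have cV : #|viol o l| = (#|viol o l :\ o f0|).+1 by rewrite (cardsD1 (o f0)) v0.
have [b1v|b1v] := boolP (o f1 \in viol o l1); last first.
  exists (tperm f0 f1); split => //.
  rewrite -addSn; apply: leq_add => //; rewrite cV ltnS; apply: subset_leq_card.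
  apply/subsetP => z zv; have := subsetP sub1 z zv; rewrite in_setU1.
  by case/orP => // /eqP ez; rewrite -ez zv in b1v.
have le1 : #|viol o l1| <= #|viol o l|.
  by apply: leq_trans (subset_leq_card sub1) _; rewrite cardsU1 cV -add1n leq_add2r leq_b1.
have l10 : l1 f0 = l f1 by rewrite /l1 /= tpermL.
have l11 : l1 f1 = l f0 by rewrite /l1 /= tpermR.
have l1o g : g != f0 -> g != f1 -> l1 g = l g.
  by move=> h0 h1; rewrite /l1 /= tpermD // eq_sym.
have vb1 g : o g = b1 -> l1 g = x.
  by case/violP: b1v => _ H eg; rewrite -f0x -l11; apply: H; rewrite ?of1.
have [|||||s [qs lts]] := IHp l1 b1 (sepby_perm qt sep) o2 (fiber2_perm _ l2).
- by exists f1.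
- exact: vb1.
(* The exchange alters the steps leaving [b] only: [f0] lies over [b] and [f1] was not labelled [x].
   The remaining path never returns to [b]. *)
- have sub : {in predC1 b &, subrel (e l) (e l1)}.
    move=> u v ub _; rewrite inE in ub; case/existsP => g /existsP[g' /and5P[gu gx q1 q2 q3]].
    apply/existsP; exists g; apply/existsP; exists g'; rewrite gu q1 q2 q3 andbT /=.
    rewrite l1o ?gx //; first by apply: contra ub => /eqP eg; rewrite -(eqP gu) eg f0b.
    by apply: contra lne => /eqP eg; rewrite -eg f0x.
  apply: (sub_in_path sub) pp; rewrite /= eq_sym bb1 /=; apply/allP => z zp /=.
  by apply: contra bp => /eqP <-.
- by rewrite /= b1p up.
- case: two => g [g' [gg eg eg' gx gx']]; exists g, g'.
  have lastb : last b1 p != b.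
    by apply: contra (_ : b \notin b1 :: p) => [/eqP <-|]; rewrite ?mem_last // inE negb_or bb1.
  have ng0 h : o h = last b1 p -> h != f0.
    by move=> eh; apply: contra lastb => /eqP e0; rewrite -eh e0 f0b.
  have ng1 h h' : h != h' -> o h = last b1 p -> o h' = last b1 p -> l h' != x -> h != f1.
    move=> hh eh eh' hx'; apply: contra hx' => /eqP e1.
    have lb1 : o h' = b1 by rewrite eh' -eh e1.
    by rewrite -(vb1 h') // l1o ?ng0 // -e1 eq_sym.
  have g1 := ng1 g g' gg eg eg' gx'.
  have g1' : g' != f1 by apply: ng1 gx => //; rewrite eq_sym.
  by split => //; rewrite l1o // ng0.
exists (s * tperm f0 f1)%g; split => [g|]; first by rewrite permM qt qs.
have el : (l1 \o s) =1 (l \o (s * tperm f0 f1)%g) by move=> g; rewrite /l1 /= permM.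
have -> : viol o (l \o (s * tperm f0 f1)%g) = viol o (l1 \o s).
  by apply/setP => z; rewrite !inE; congr andb; apply: eq_forallb => g; apply: eq_forallb => g'; rewrite !el.
have -> : viol (l \o (s * tperm f0 f1)%g) o = viol (l1 \o s) o.
  apply/setP => z; rewrite !inE; congr andb; first by apply: eq_existsb => g; rewrite el.
  by apply: eq_forallb => g; apply: eq_forallb => g'; rewrite !el.
by apply: leq_trans lts _; apply: leq_add.
Qed.

(* Exchanges at the classes of q move the violation from u to v when an element of
   u labelled x shares its class with another element of v. If every value reached
   from b this way had at most one element not labelled x, then mapping each element
   labelled x to another one of its class would inject more than #|R| elements into
   fewer than #|R|. *)
Lemma viol_improve (F Q O L : finType) (q : F -> Q) (o : F -> O) (l : F -> L) b :
  sepby q l -> fiber2 q -> fiber2 o -> fiber2 l -> b \in viol o l ->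
  exists s : {perm F}, (forall f, q (s f) = q f) /\
    #|viol o (l \o s)| + #|viol (l \o s) o| < #|viol o l| + #|viol l o|.
Proof.
move=> sep q2 o2 l2 /violP[[fb efb] vb]; pose x := l fb.
have vx f : o f = b -> l f = x by move=> e; apply: vb.
pose e u v := [exists f, exists f',
    [&& o f == u, l f == x, q f == q f', f != f' & o f' == v]].
pose R := [set z | connect e b z].
pose two z := [exists f, exists f',
    [&& f != f', o f == z, o f' == z, l f != x & l f' != x]].
have [/existsP[z /andP[zR /existsP[f /existsP[f' /and5P[ff ez ez' fx fx']]]]]|none] :=
  boolP [exists z, (z \in R) && two z].
  rewrite inE in zR; case/connectP: zR => p pp ep.
  case/shortenP: pp ep => p' pp' up' _ ep'.
  apply: (improve_along_path (x := x) (b := b) (p := p')) => //; first by exists fb.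
  by exists f, f'; rewrite (eqP ez) (eqP ez') -ep'.
have le1 z f f' : z \in R -> o f = z -> o f' = z -> l f != x -> l f' != x -> f = f'.
  move=> zR ez ez' fx fx'; apply/eqP; apply: contraR none => ff.
  apply/existsP; exists z; rewrite zR; apply/existsP; exists f; apply/existsP; exists f'.
  by rewrite ff ez ez' eqxx fx fx'.
pose X := [set f | (o f \in R) && (l f == x)].
pose N := [set f | (o f \in R) && (l f != x)].
pose h f := odflt f [pick f' | (f' != f) && (q f' == q f)].
have hP f : h f != f /\ q (h f) = q f.
  rewrite /h; case: pickP => [f' /andP[? /eqP ?] //|no].
  by have [f' ne e'] := q2 f; have := no f'; rewrite ne e' eqxx.
have bR : b \in R by rewrite inE connect0.
(* The contradiction is [#|R| <= #|X| <= #|N| < #|R|]: a reached value has at least two elements, at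
   most one of them not labelled [x], and [b] has none of the latter. *)
have leXN : #|X| <= #|N|.
  rewrite -(card_in_imset (f := h) (D := X)).
    apply/subset_leq_card/subsetP => g /imsetP[f]; rewrite !inE => /andP[fR /eqP fx] ->.
    have [hne hq] := hP f; apply/andP; split.
      apply: (connect_trans fR); apply: connect1; apply/existsP; exists f.
      by apply/existsP; exists (h f); rewrite !eqxx fx eqxx hq eqxx eq_sym hne.
    by apply: contra hne => /eqP hx; apply/eqP/sep => //; rewrite hx fx.
  move=> f f'; rewrite !inE => /andP[_ /eqP fx] /andP[_ /eqP fx'] eh.
  by apply: sep; [rewrite -(hP f).2 eh (hP f').2 | rewrite fx fx'].
have ltN : #|N| < #|R|.
  rewrite (cardsD1 b R) bR ltnS -(card_in_imset (f := o) (D := N)).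
    apply/subset_leq_card/subsetP => z /imsetP[f]; rewrite inE => /andP[fR fx] ->.
    by rewrite in_setD1 fR andbT; apply: contra fx => /eqP/vx->.
  move=> f f'; rewrite !inE => /andP[fR fx] /andP[fR' fx'] eo.
  by apply: (le1 (o f)) => //; rewrite inE.
have leR : #|R| <= #|X|.
  apply: leq_trans (leq_imset_card o X); apply/subset_leq_card/subsetP => z zR.
  have [f ez] : exists f, o f = z.
    move: (zR); rewrite inE => /connectP[p]; elim/last_ind: p => [|p y _] /=.
      by move=> _ ->; exists fb.
    rewrite rcons_path last_rcons => /andP[_ /existsP[f /existsP[f' /and5P[_ _ _ _ /eqP e']]]] ->.
    by exists f'.
  have [f' ne e'] := o2 f.
  have [fx|fx] := eqVneq (l f) x; first by apply/imsetP; exists f; rewrite // inE ez zR fx eqxx.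
  have [fx'|fx'] := eqVneq (l f') x.
    by apply/imsetP; exists f'; rewrite ?e' // inE e' ez zR fx' eqxx.
  by move: ne; rewrite (le1 z f' f) ?eqxx // e'.
by have := leq_ltn_trans (leq_trans leR leXN) ltN; rewrite ltnn.
Qed.

Lemma eq_viol (F O L : finType) (o o' : F -> O) (l l' : F -> L) :
  o =1 o' -> l =1 l' -> viol o l = viol o' l'.
Proof.
move=> eo el; apply/setP => z; rewrite !inE; congr andb.
  by apply: eq_existsb => f; rewrite eo.
by apply: eq_forallb => f; apply: eq_forallb => f'; rewrite !eo !el.
Qed.

(** The total number of violations of both kinds decreases: [t] removes those of one kind and, with
    the roles of the two sides exchanged, [s] those of the other. *)
Lemma no_viol (F P Q O L : finType) (p : F -> P) (q : F -> Q) (o : F -> O) (l : F -> L) :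
  sepby p o -> sepby q l -> fiber2 p -> fiber2 q -> fiber2 o -> fiber2 l ->
  exists s t : {perm F}, [/\ forall f, p (s f) = p f, forall f, q (t f) = q f,
    viol (o \o s) (l \o t) = set0 & viol (l \o t) (o \o s) = set0].
Proof.
move=> so sl p2 q2 o2 l2.
suff ind n : forall s t : {perm F}, (forall f, p (s f) = p f) -> (forall f, q (t f) = q f) ->
    #|viol (o \o s) (l \o t)| + #|viol (l \o t) (o \o s)| <= n ->
    exists s t : {perm F}, [/\ forall f, p (s f) = p f, forall f, q (t f) = q f,
    viol (o \o s) (l \o t) = set0 & viol (l \o t) (o \o s) = set0].
  by apply: (ind _ 1%g 1%g) (leqnn _) => f; rewrite perm1.
have conv (K : finType) (k : F -> K) (s t : {perm F}) : (k \o s) \o t =1 k \o (t * s)%g.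
  by move=> f; rewrite /= permM.
elim: n => [|n IHn] s t ps qt len.
  move: len; rewrite leqn0 addn_eq0 !cards_eq0 => /andP[/eqP v1 /eqP v2].
  by exists s, t.
have [v1|[b bv]] := set_0Vmem (viol (o \o s) (l \o t)).
  have [v2|[b bv]] := set_0Vmem (viol (l \o t) (o \o s)); first by exists s, t.
  have [||||s' [ps' lt]] := viol_improve (q := p) _ _ _ _ bv; last first.
  - apply: (IHn (s' * s)%g t) => // [f|]; first by rewrite permM ps ps'.
    rewrite addnC -ltnS; apply: leq_trans _ len; rewrite [X in _ < X]addnC.
    by move: lt; rewrite !(eq_viol (conv _ _ _ _) (frefl _)) !(eq_viol (frefl _) (conv _ _ _ _)).
  - exact: fiber2_perm.
  - exact: fiber2_perm.
  - by [].
  - exact: sepby_perm.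
have [||||t' [qt' lt]] := viol_improve (q := q) _ _ _ _ bv; last first.
- apply: (IHn s (t' * t)%g) => // [f|]; first by rewrite permM qt qt'.
  rewrite -ltnS; apply: leq_trans _ len.
  by move: lt; rewrite !(eq_viol (conv _ _ _ _) (frefl _)) !(eq_viol (frefl _) (conv _ _ _ _)).
- exact: fiber2_perm.
- exact: fiber2_perm.
- by [].
- exact: sepby_perm.
Qed.

(** The map [h0] only supplies values outside [D], which could not be chosen when [X] is empty. *)
Lemma keyed_bijection_in (F X V : finType) (D : {set F}) (k : F -> V) (S : {set X})
    (k' : X -> V) (h0 : F -> X) :
  (forall v, #|fib D k v| = #|fib S k' v|) ->
  exists h : F -> X, [/\ {in D &, injective h},
    forall f, f \in D -> h f \in S /\ k' (h f) = k f &
    forall x, x \in S -> exists2 f, f \in D & h f = x].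
Proof.
move: {2}#|D| (leqnn #|D|) => n; elim: n D S => [|n IHn] D S leD eqc.
  move: leD; rewrite leqn0 cards_eq0 => /eqP D0; exists h0; split => [f|f|x xS].
  - by rewrite D0 inE.
  - by rewrite D0 inE.
  have : 0 < #|fib S k' (k' x)| by rewrite card_gt0; apply/set0Pn; exists x; rewrite in_fib xS eqxx.
  by rewrite -eqc D0 fib_set0 cards0.
have [D0|[f fD]] := set_0Vmem D; first by apply: IHn; rewrite ?D0 ?cards0 // -D0.
have : 0 < #|fib S k' (k f)|.
  by rewrite -eqc card_gt0; apply/set0Pn; exists f; rewrite in_fib fD eqxx.
rewrite card_gt0 => /set0Pn[x]; rewrite in_fib => /andP[xS /eqP kx].
have fibD1 (Y : finType) (B : {set Y}) (j : Y -> V) y v : y \in B ->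
    #|fib B j v| = (j y == v) + #|fib (B :\ y) j v|.
  move=> yB; rewrite (cardsD1 y) in_fib yB; congr (_ + _).
  by apply: eq_card => z; rewrite !inE andbA.
have [||h [hinj hS hsur]] := IHn (D :\ f) (S :\ x).
- by move: leD; rewrite (cardsD1 f) fD add1n ltnS.
- by move=> v; apply/eqP; rewrite -(eqn_add2l (k f == v)) -fibD1 // eqc (fibD1 _ _ _ x) // kx.
exists (fun g => if g == f then x else h g); split.
- move=> g g' gD g'D; have [->|gf] := eqVneq g f; have [->|g'f] := eqVneq g' f => //.
  + by move=> e; have [] := hS g'; rewrite !inE ?g'f // -e eqxx.
  + by move=> e; have [] := hS g; rewrite !inE ?gf // e eqxx.
  by apply: hinj; rewrite !inE ?gf ?g'f.
- move=> g gD; have [->|gf] := eqVneq g f; first by rewrite kx.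
  by have [] := hS g; rewrite !inE ?gf // => /andP[].
- move=> y yS; have [->|yx] := eqVneq y x; first by exists f; rewrite ?eqxx.
  have [|g] := hsur y; first by rewrite !inE yx.
  by rewrite !inE => /andP[gf gD] <-; exists g; rewrite // (negPf gf).
Qed.

Lemma keyed_bijection (F X V : finType) (k : F -> V) (S : {set X}) (k' : X -> V) :
  (forall v, #|[set f | k f == v]| = #|fib S k' v|) ->
  exists h : F -> X, [/\ injective h, forall f, h f \in S /\ k' (h f) = k f &
    forall x, x \in S -> exists f, h f = x].
Proof.
move=> eqc.
have ex f : exists x, x \in fib S k' (k f).
  by apply/set0Pn; rewrite -card_gt0 -eqc card_gt0; apply/set0Pn; exists f; rewrite inE.
have [|h [hinj hS hsur]] := keyed_bijection_in (D := [set: F]) (k := k) (S := S) (k' := k')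
    (fun f => xchoose (ex f)).
  by move=> v; rewrite -eqc; apply: eq_card => f; rewrite !inE.
exists h; split => [f f'|f|x /hsur[f _ <-]].
- by apply: hinj; rewrite inE.
- by apply: hS; rewrite inE.
- by exists f.
Qed.

(* A fixed point of the forbidden relation is exchanged with an element of the same
   fibre carrying another forbidden value. *)
Lemma keyed_bijection_avoid (F X V L : finType) (k : F -> V) (S : {set X}) (k' : X -> V)
    (val : X -> L) (lab : F -> L) :
  (forall v, #|[set f | k f == v]| = #|fib S k' v|) ->
  (forall f, exists2 f', k f' = k f & lab f' != lab f) ->
  sepby k' val ->
  exists h : F -> X, [/\ injective h, forall f, h f \in S /\ k' (h f) = k f,
    forall x, x \in S -> exists f, h f = x & forall f, val (h f) != lab f].
Proof.
move=> eqc nonc sep.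
have [h0 h0P] := keyed_bijection eqc.
suff ind n : forall h : F -> X, [/\ injective h, forall f, h f \in S /\ k' (h f) = k f &
    forall x, x \in S -> exists f, h f = x] -> #|[set f | val (h f) == lab f]| <= n ->
  exists h : F -> X, [/\ injective h, forall f, h f \in S /\ k' (h f) = k f,
    forall x, x \in S -> exists f, h f = x & forall f, val (h f) != lab f].
  exact: (ind _ h0 h0P (leqnn _)).
elim: n => [|n IHn] h [hinj hS hsur] len.
  exists h; split => // f; apply/negP => bad.
  by move: len; rewrite leqn0 cards_eq0 => /eqP/setP/(_ f); rewrite !inE bad.
have [none|[f]] := set_0Vmem [set f | val (h f) == lab f].
  by exists h; split => // f; have/setP/(_ f) := none; rewrite !inE => /negbT.
rewrite inE => /eqP bad; have [f' kf' lf'] := nonc f.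
have kt g : k (tperm f f' g) = k g by case: tpermP => // ->.
apply: (IHn (h \o tperm f f')).
  split => [g g' /hinj/perm_inj //|g|x /hsur[g <-]].
    by rewrite /= -[in RHS](kt g); apply: hS.
  by exists (tperm f f' g); rewrite /= tpermK.
rewrite -ltnS; apply: leq_trans _ len; apply: proper_card; apply/properP; split.
  apply/subsetP => g; rewrite !inE /=; case: tpermP => [->|->|//].
    move/eqP=> e; have : h f' = h f by apply: sep; rewrite ?(hS _).2 // e bad.
    by move/hinj => e'; rewrite e' eqxx in lf'.
  by rewrite bad eq_sym (negPf lf').
exists f; rewrite !inE ?bad //= tpermL; apply/negP => /eqP e.
have : h f' = h f by apply: sep; rewrite ?(hS _).2 // e bad.
by move/hinj => e'; rewrite e' eqxx in lf'.
Qed.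

(** Each edge is listed once, starting at its end in A, so [fst] and [snd] are the end maps of the
    two sides and [fib] gives the edges at a vertex. *)
Definition arcs (T : finType) (e : rel T) (A : {set T}) : {set T * T} :=
  [set u | e u.1 u.2 & u.1 \in A].

Definition colour (T : finType) (E : {set T * T}) (c : T * T -> nat) (i : nat) :
  {set T * T} := [set u in E | c u == i].

Lemma fiber2_card (F V : finType) (k : F -> V) :
  (forall v, #|[set f | k f == v]| != 1) -> fiber2 k.
Proof.
move=> H f; have := H (k f); rewrite (cardsD1 f) inE eqxx add1n eqSS cards_eq0.
by case/set0Pn => g; rewrite !inE => /andP[gf /eqP e]; exists g.
Qed.

Lemma card_sig_fib (X V : finType) (S : {set X}) (k : X -> V) v :
  #|[set f : {u | u \in S} | k (val f) == v]| = #|fib S k v|.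
Proof.
rewrite -(card_imset _ val_inj); apply: eq_card => u; rewrite in_fib.
apply/imsetP/andP => [[f]|[uS ku]].
  by rewrite inE => kf ->; split; first exact: (valP f).
by exists (exist _ u uS); rewrite ?inE.
Qed.

Lemma card_bij_fib (F X V : finType) (S : {set X}) (h : F -> X) (k : X -> V) v :
  injective h -> (forall f, h f \in S) -> (forall x, x \in S -> exists f, h f = x) ->
  #|[set f | k (h f) == v]| = #|fib S k v|.
Proof.
move=> hinj hS hsur; rewrite -(card_imset _ hinj); apply: eq_card => u; rewrite in_fib.
apply/imsetP/andP => [[f]|[uS ku]].
  by rewrite inE => kf ->.
by have [f hf] := hsur u uS; exists f; rewrite ?inE ?hf.
Qed.

Lemma edge_inj (T : finType) (A : {set T}) (u v : T * T) :
  u.1 \in A -> u.2 \notin A -> v.1 \in A -> v.2 \notin A ->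
  [set u.1; u.2] = [set v.1; v.2] -> u = v.
Proof.
case: u v => [a b] [a' b'] /= aA bA a'A b'A eq2.
have : a \in [set a'; b'] by rewrite -eq2 !inE eqxx.
have : b \in [set a'; b'] by rewrite -eq2 !inE eqxx orbT.
rewrite !inE => /orP[/eqP eb|/eqP->]; first by rewrite eb a'A in bA.
by case/orP=> [/eqP->//|/eqP ea]; rewrite -ea aA in b'A.
Qed.

(** Paths are indexed by their middle edges, of colour 3. The second and fourth edges are glued
    first and rearranged by [no_viol]; then at every vertex where a first edge is to be attached two
    different vertices must be avoided by the walks ending there, which lets [keyed_bijection_avoid]
    attach it without a repetition, and likewise for the fifth edges. *)
Lemma path_decomposition_of_colouring (T : finType) (e : rel T) (A : {set T})
    (c : T * T -> nat) :
  symmetric e -> (forall x y, e x y -> (x \in A) != (y \in A)) ->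
  let E := arcs e A in let C := colour E c in
  (forall u, u \in E -> 0 < c u <= 5) ->
  (forall v, #|fib (C 2) fst v| = #|fib (C 3) fst v| /\ #|fib (C 3) fst v| != 1) ->
  (forall v, #|fib (C 4) fst v| = #|fib (C 5) fst v| /\ #|fib (C 4) fst v| != 1) ->
  (forall v, #|fib (C 1) snd v| = #|fib (C 2) snd v| /\ #|fib (C 2) snd v| != 1) ->
  (forall v, #|fib (C 3) snd v| = #|fib (C 4) snd v| /\ #|fib (C 3) snd v| != 1) ->
  path_decomposition 5 e.
Proof.
move=> es ebip E C c15 A23 A45 B12 B34.
have EP u : u \in E -> [/\ e u.1 u.2, u.1 \in A & u.2 \notin A].
  rewrite inE => /andP[eu uA]; split => //.
  by have := ebip _ _ eu; rewrite uA; case: (u.2 \in A).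
have Ein u : e u.1 u.2 -> u.1 \in A -> u \in E by rewrite inE => -> ->.
have CE i u : u \in C i -> u \in E /\ c u = i by rewrite inE => /andP[? /eqP].
have inC i u : u \in E -> c u == i -> u \in C i by rewrite [in X in _ -> X]inE => -> ->.
clearbody C; clearbody E.
pose F := {u : T * T | u \in C 3}.
pose p (f : F) := (val f).1; pose q (f : F) := (val f).2.
have cardp v : #|[set f | p f == v]| = #|fib (C 3) fst v| by apply: card_sig_fib.
have cardq v : #|[set f | q f == v]| = #|fib (C 3) snd v| by apply: card_sig_fib.
have [e2 [e2inj e2S e2sur]] : exists h : F -> T * T, [/\ injective h,
   forall f, h f \in C 2 /\ (h f).1 = p f & forall x, x \in C 2 -> exists f, h f = x].
  by apply: keyed_bijection => v; rewrite cardp (A23 v).1.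
have [e4 [e4inj e4S e4sur]] : exists h : F -> T * T, [/\ injective h,
   forall f, h f \in C 4 /\ (h f).2 = q f & forall x, x \in C 4 -> exists f, h f = x].
  by apply: keyed_bijection => v; rewrite cardq (B34 v).1.
pose o f := (e2 f).2; pose l f := (e4 f).1.
have so : sepby p o.
  by move=> f f' pp oo; apply: e2inj; apply: injective_projections => //; rewrite !(e2S _).2.
have sl : sepby q l.
  by move=> f f' pp oo; apply: e4inj; apply: injective_projections => //; rewrite !(e4S _).2.
have cardo v : #|[set f | o f == v]| = #|fib (C 2) snd v|.
  by apply: (card_bij_fib (h := e2) snd v e2inj _ e2sur) => f; have [] := e2S f.
have cardl v : #|[set f | l f == v]| = #|fib (C 4) fst v|.
  by apply: (card_bij_fib (h := e4) fst v e4inj _ e4sur) => f; have [] := e4S f.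
have p2 : fiber2 p by apply: fiber2_card => v; rewrite cardp (A23 v).2.
have q2 : fiber2 q by apply: fiber2_card => v; rewrite cardq (B34 v).2.
have o2 : fiber2 o by apply: fiber2_card => v; rewrite cardo (B12 v).2.
have l2 : fiber2 l by apply: fiber2_card => v; rewrite cardl (A45 v).2.
have [s [t [ps qt v1 v2]]] := no_viol so sl p2 q2 o2 l2.
have permcard (k : F -> T) (r : {perm F}) v : #|[set f | k (r f) == v]| = #|[set f | k f == v]|.
  rewrite -(card_imset _ (@perm_inj _ r)); apply: eq_card => g; rewrite inE.
  apply/imsetP/idP => [[f]|kg]; first by rewrite inE => kf ->.
  by exists (r^-1%g g); rewrite ?inE permKV.
have nonc (k k' : F -> T) : viol k k' = set0 -> forall f, exists2 f', k f' = k f & k' f' != k' f.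
  move=> v0 f; have [/existsP[f' /andP[/eqP ? ?]]|none] :=
    boolP [exists f', (k f' == k f) && (k' f' != k' f)]; first by exists f'.
  have ke g : k g = k f -> k' g = k' f.
    move=> e1; apply/eqP; apply: contraR none => ne.
    by apply/existsP; exists g; rewrite e1 eqxx.
  have : k f \in viol k k'.
    by apply/violP; split; [exists f | move=> g g' /ke-> /ke->].
  by rewrite v0 inE.
have [e1 [e1inj e1S e1sur e1ne]] : exists h : F -> T * T, [/\ injective h,
   forall f, h f \in C 1 /\ (h f).2 = o (s f), forall x, x \in C 1 -> exists f, h f = x
   & forall f, (h f).1 != l (t f)].
  apply: (keyed_bijection_avoid (k := o \o s) (lab := l \o t)) => [v||u v].
  - by rewrite permcard cardo (B12 v).1.
  - exact: nonc.
  - by move=> ? ?; apply: injective_projections.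
have [e5 [e5inj e5S e5sur e5ne]] : exists h : F -> T * T, [/\ injective h,
   forall f, h f \in C 5 /\ (h f).1 = l (t f), forall x, x \in C 5 -> exists f, h f = x
   & forall f, (h f).2 != o (s f)].
  apply: (keyed_bijection_avoid (k := l \o t) (lab := o \o s)) => [v||u v].
  - by rewrite permcard cardl (A45 v).1.
  - exact: nonc.
  - by move=> ? ?; apply: injective_projections.
pose S f := [:: e1 f; e2 (s f); val f; e4 (t f); e5 f].
have SE f u : u \in S f -> u \in E.
  have vC : val f \in C 3 by apply: valP.
  rewrite !inE => /or4P[|||/orP[]] /eqP->; first exact: (CE _ _ (e1S f).1).1.
  - exact: (CE _ _ (e2S _).1).1.
  - exact: (CE _ _ vC).1.
  - exact: (CE _ _ (e4S _).1).1.
  - exact: (CE _ _ (e5S f).1).1.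
have Sinj f f' u : u \in S f -> u \in S f' -> f = f'.
  have c1 g := (CE _ _ (e1S g).1).2; have c2 g := (CE _ _ (e2S g).1).2.
  have c3 g := (CE _ _ (valP g : val g \in C 3)).2.
  have c4 g := (CE _ _ (e4S g).1).2; have c5 g := (CE _ _ (e5S g).1).2.
  rewrite !inE => /or4P[|||/orP[]] /eqP-> /or4P[|||/orP[]] /eqP eu;
    try (by have := congr1 c eu; rewrite ?c1 ?c2 ?c3 ?c4 ?c5).
  - exact: e1inj.
  - by apply: (@perm_inj _ s); apply: e2inj.
  - exact: val_inj.
  - by apply: (@perm_inj _ t); apply: e4inj.
  - exact: e5inj.
have Ssur u : u \in E -> exists f, u \in S f.
  move=> uE.
  have [/e1sur[f ef]|n1] := boolP (u \in C 1); first by exists f; rewrite !inE ef eqxx.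
  have [/e2sur[f ef]|n2] := boolP (u \in C 2).
    by exists (s^-1%g f); rewrite !inE permKV ef eqxx orbT.
  have [u3|n3] := boolP (u \in C 3).
    by exists (exist _ u u3); rewrite !inE /= eqxx !orbT.
  have [/e4sur[f ef]|n4] := boolP (u \in C 4).
    by exists (t^-1%g f); rewrite !inE permKV ef eqxx !orbT.
  have [/e5sur[f ef]|n5] := boolP (u \in C 5).
    by exists f; rewrite !inE ef eqxx !orbT.
  have nc i : u \notin C i -> c u != i by apply: contra => /(inC i u uE).
  move: (nc _ n1) (nc _ n2) (nc _ n3) (nc _ n4) (nc _ n5) (c15 u uE).
  by case: (c u) => [|[|[|[|[|[|?]]]]]].
pose ed (u : T * T) := [set u.1; u.2].
pose B f := [set ed u | u in S f].
exists [set B f | f : F]; split; last first.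
  move=> _ /imsetP[f _ ->].
  pose a0 := (e1 f).1; pose b1 := o (s f); pose a1 := p f; pose b2 := q f.
  pose a2 := l (t f); pose b3 := (e5 f).2.
  have E1 : e1 f = (a0, b1) by rewrite /b1 -(e1S f).2 /a0 -surjective_pairing.
  have E2 : e2 (s f) = (a1, b1).
    by rewrite /a1 -(ps f) -(e2S (s f)).2 /b1 /o -surjective_pairing.
  have E3 : val f = (a1, b2) by rewrite -surjective_pairing.
  have E4 : e4 (t f) = (a2, b2).
    by rewrite /b2 -(qt f) -(e4S (t f)).2 /a2 /l -surjective_pairing.
  have E5 : e5 f = (a2, b3) by rewrite /a2 -(e5S f).2 /b3 -surjective_pairing.
  have in1 := EP _ (CE _ _ (e1S f).1).1; rewrite E1 /= in in1.
  have in2 := EP _ (CE _ _ (e2S (s f)).1).1; rewrite E2 /= in in2.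
  have in3 := EP _ (CE _ _ (valP f : val f \in C 3)).1; rewrite E3 /= in in3.
  have in4 := EP _ (CE _ _ (e4S (t f)).1).1; rewrite E4 /= in in4.
  have in5 := EP _ (CE _ _ (e5S f).1).1; rewrite E5 /= in in5.
  case: in1 in2 in3 in4 in5 => [h1 a0A b1A] [h2 a1A _] [h3 _ b2A] [h4 a2A _] [h5 _ b3A].
  have AB x y : x \in A -> y \notin A -> x != y by move=> xA yA; apply: contra yA => /eqP <-.
  have c1 := (CE _ _ (e1S f).1).2; have c2 := (CE _ _ (e2S (s f)).1).2.
  have c3 := (CE _ _ (valP f : val f \in C 3)).2.
  have c4 := (CE _ _ (e4S (t f)).1).2; have c5 := (CE _ _ (e5S f).1).2.
  rewrite E1 in c1; rewrite E2 in c2; rewrite E3 in c3; rewrite E4 in c4; rewrite E5 in c5.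
  (* Consecutive edges of the walk have different colours and are therefore different arcs, which
     separates vertices at distance two. Only [a0 != a2] and [b1 != b3] depend on the exchanges. *)
  have a01 : a0 != a1 by apply/eqP => ea; move: c1; rewrite ea c2.
  have a12 : a1 != a2 by apply/eqP => ea; move: c3; rewrite ea c4.
  have a02 : a0 != a2 by apply: e1ne.
  have b12 : b1 != b2 by apply/eqP => ea; move: c2; rewrite ea c3.
  have b23 : b2 != b3 by apply/eqP => ea; move: c4; rewrite ea c5.
  have b13 : b1 != b3 by rewrite eq_sym; apply: e5ne.
  exists a0, [:: b1; a1; b2; a2; b3]; split => //.
  - rewrite /= !inE !negb_or a01 a02 a12 b12 b23 b13 !andbT /=.
    by rewrite !(AB a0) // !(AB a1) // !(AB a2) // ?[_ == a1]eq_sym ?[_ == a2]eq_sym ?(AB a1) ?(AB a2).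
  - by rewrite /= h1 h3 h5 ![e b1 _]es ![e b2 _]es h2 h4.
  - apply/setP => X; apply/imsetP/imsetP => -[u].
      rewrite /S E1 E2 E3 E4 E5 !inE => /or4P[|||/orP[]] /eqP-> ->.
      + by exists (a0, b1); rewrite ?inE ?eqxx.
      + by exists (b1, a1); rewrite ?inE ?eqxx ?orbT // /ed /= setUC.
      + by exists (a1, b2); rewrite ?inE ?eqxx ?orbT.
      + by exists (b2, a2); rewrite ?inE ?eqxx ?orbT // /ed /= setUC.
      + by exists (a2, b3); rewrite ?inE ?eqxx ?orbT.
    rewrite /= !inE => /or4P[|||/orP[]] /eqP-> ->.
    + by exists (a0, b1); rewrite /S ?E1 ?inE ?eqxx.
    + by exists (a1, b1); rewrite /S ?E2 ?inE ?eqxx ?orbT // /ed /= setUC.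
    + by exists (a1, b2); rewrite /S ?E3 ?inE ?eqxx ?orbT.
    + by exists (a2, b2); rewrite /S ?E4 ?inE ?eqxx ?orbT // /ed /= setUC.
    + by exists (a2, b3); rewrite /S ?E5 ?inE ?eqxx ?orbT.
have edinj u v : u \in E -> v \in E -> ed u = ed v -> u = v.
  by move=> /EP[_ ? ?] /EP[_ ? ?]; apply: (edge_inj (A := A)).
apply/and3P; split.
- rewrite eqEsubset; apply/andP; split; apply/subsetP => X.
    case/bigcupP => _ /imsetP[f _ ->] /imsetP[u /SE /EP[eu _ _] ->].
    by apply/imsetP; exists u; rewrite ?inE.
  case/imsetP => u; rewrite inE => eu ->; have := ebip _ _ eu.
  have fin w : w \in E -> ed w \in cover [set B f | f : F].
    move=> wE; have [f wf] := Ssur w wE; apply/bigcupP; exists (B f); first by apply: imset_f.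
    by apply/imsetP; exists w.
  case uA: (u.1 \in A) => /= u2A; first by apply/fin/Ein.
  rewrite setUC; apply: (fin (u.2, u.1)); apply: Ein; rewrite /= 1?es //.
  by move: u2A; case: (u.2 \in A).
- apply/trivIsetP => _ _ /imsetP[f _ ->] /imsetP[f' _ ->]; apply: contraR.
  rewrite -setI_eq0 => /set0Pn[X]; rewrite inE => /andP[/imsetP[u uf ->] /imsetP[u' uf' eu]].
  have uu : u = u' by apply: edinj => //; [apply: SE uf | apply: SE uf'].
  by rewrite (Sinj f f' u) // uu.
- apply/imsetP => -[f _ /setP/(_ (ed (val f)))]; rewrite inE => /esym/negP; apply.
  by apply/imsetP; exists (val f); rewrite // !inE eqxx !orbT.
Qed.

(** * Sparse disjoint connected sets *)

Definition submodular (X : finType) (f : {set X} -> nat) :=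
  forall Y Z, f (Y :|: Z) + f (Y :&: Z) <= f Y + f Z.

Definition monotone (X : finType) (f : {set X} -> nat) :=
  forall Y Z : {set X}, Y \subset Z -> f Y <= f Z.

(* Rado's theorem with deficiency. An element can be removed from any set with two elements y, z:
   otherwise violators J and K for y and z give, by submodularity, a violation at J :|: K
   or at J :&: K without i. *)
Lemma rado_choice (I X : finType) (x0 : X) (f : {set X} -> nat) (A : I -> {set X}) (D : {set I}) p :
  monotone f -> submodular f -> (forall i, i \in D -> A i != set0) ->
  (forall J : {set I}, J \subset D -> #|J| + p <= f (\bigcup_(i in J) A i) + #|D|) ->
  exists2 x : I -> X, forall i, i \in D -> x i \in A i & p <= f [set x i | i in D].
Proof.
move=> fm fs; have [n] := ubnP (\sum_(i in D) #|A i|); elim: n A => // n IHn A ltn An0 H.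
have [/existsP[i /andP[iD /card_gt1P[y [z [yA zA yz]]]]]|none] :=
  boolP [exists i, (i \in D) && (1 < #|A i|)]; last first.
  have ex i : exists x, i \in D -> A i = [set x].
    have [iD|] := boolP (i \in D); last by exists x0.
    have : ~~ (1 < #|A i|) by apply: contra none => h; apply/existsP; exists i; rewrite iD.
    rewrite -leqNgt leq_eqVlt ltnS leqn0 cards_eq0 (negPf (An0 i iD)) orbF.
    by case/cards1P=> x ->; exists x.
  have /fin_all_exists [x xP] := ex; exists x => [i iD|].
    by rewrite (xP i iD) inE.
  have := H D (subxx _); rewrite addnC leq_add2r => /leq_trans; apply; apply: fm.
  apply/subsetP => y /bigcupP[i iD]; rewrite (xP i iD) inE => /eqP ->.
  by apply: imset_f.
pose A' y j := if j == i then A i :\ y else A j.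
have A'i w : A' w i = A i :\ w by rewrite /A' eqxx.
have A'j w j : j != i -> A' w j = A j by rewrite /A' => /negPf->.
have sA' w j : A' w j \subset A j.
  by rewrite /A'; case: eqP => [->|_] //; apply: subsetDl.
have step w w' : w \in A i -> w' \in A i -> w != w' ->
    (forall J : {set I}, J \subset D -> #|J| + p <= f (\bigcup_(j in J) A' w j) + #|D|) ->
    exists2 x : I -> X, forall j, j \in D -> x j \in A j & p <= f [set x j | j in D].
  move=> wA w'A ww' H'; have [||//|x xA px] := IHn (A' w).
  - move: ltn; rewrite ltnS; apply: leq_trans; rewrite (bigD1 i) //= [X in _ < X](bigD1 i) //=.
    rewrite A'i [#|A i|](cardsD1 w) wA add1n addSn ltnS leq_add2l.
    by apply: leq_sum => j _; apply/subset_leq_card/sA'.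
  - move=> j jD; have [->|ji] := eqVneq j i; last by rewrite A'j ?An0.
    by rewrite A'i; apply/set0Pn; exists w'; rewrite !inE eq_sym ww'.
  - by exists x => // j jD; apply: (subsetP (sA' w j)); apply: xA.
have viol w : (forall J : {set I}, J \subset D -> #|J| + p <= f (\bigcup_(j in J) A' w j) + #|D|) \/
   exists J : {set I}, [/\ J \subset D, i \in J & f (\bigcup_(j in J) A' w j) + #|D| < #|J| + p].
  have [/existsP[J /andP[JD lt]]|nJ] := boolP [exists J : {set I}, (J \subset D) &&
      (f (\bigcup_(j in J) A' w j) + #|D| < #|J| + p)].
    right; exists J; split => //; apply: contraLR lt => iJ; rewrite -leqNgt.
    rewrite (eq_bigr A) ?H // => j jJ; apply: A'j; by apply: contraNneq iJ => <-.
  left => J JD; rewrite leqNgt; apply: contra nJ => lt; by apply/existsP; exists J; rewrite JD.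
have [Hy|[J [JD iJ ltJ]]] := viol y; first exact: (step y z).
have [Hz|[K [KD iK ltK]]] := viol z; first by apply: (step z y) => //; rewrite eq_sym.
exfalso; set U := \bigcup_(j in J) _ in ltJ; set W := \bigcup_(j in K) _ in ltK.
have h1 : f (\bigcup_(j in J :|: K) A j) <= f (U :|: W).
  apply: fm; apply/subsetP => x /bigcupP[j jJK xA].
  have [ji|ji] := eqVneq j i.
    rewrite inE; have [xy|xy] := eqVneq x y.
      by apply/orP; right; apply/bigcupP; exists i => //; rewrite A'i !inE xy yz -ji -xy.
    by apply/orP; left; apply/bigcupP; exists i => //; rewrite A'i !inE xy -ji.
  rewrite inE; move: jJK; rewrite inE => /orP[jJ|jK]; apply/orP; [left|right];
  by apply/bigcupP; exists j => //; rewrite A'j.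
have h2 : f (\bigcup_(j in (J :&: K) :\ i) A j) <= f (U :&: W).
  apply: fm; apply/subsetP => x /bigcupP[j]; rewrite !inE => /and3P[ji jJ jK] xA.
  by apply/andP; split; apply/bigcupP; exists j => //; rewrite A'j.
have h3 := fs U W.
have h4 : #|J :|: K| + p <= f (\bigcup_(j in J :|: K) A j) + #|D|.
  by apply: H; rewrite subUset JD.
have h5 : #|(J :&: K) :\ i| + p <= f (\bigcup_(j in (J :&: K) :\ i) A j) + #|D|.
  by apply: H; apply: subset_trans JD; apply: subset_trans (subsetIl J K); apply: subsetDl.
have h6 := cardsUI J K.
have h7 := cardsD1 i (J :&: K); rewrite !inE iJ iK /= in h7.
move: h1 h2 h3 h4 h5 h6 h7 ltJ ltK; move: (f _) (f _) (f _) (f _) (f _) (f _) => *; lia.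
Qed.

(** * The rank of the graphic matroid *)

Section GraphicRank.
Import GRing.Theory.
Local Open Scope ring_scope.

Definition unitv (T : finType) (x : T) : 'rV[rat]_#|T| := delta_mx 0 (enum_rank x).

Definition edge_space (T : finType) (Y : {set T * T}) : 'M[rat]_#|T| :=
  (\sum_(u in Y) <<unitv u.1 - unitv u.2>>)%MS.

(** Taken as the dimension spanned by the incidence vectors over the rationals, so that
    submodularity follows from the dimension formula for sums and intersections of subspaces. *)
Definition graphic_rank (T : finType) (Y : {set T * T}) : nat := \rank (edge_space Y).

Lemma edge_space_sub (T : finType) (Y Z : {set T * T}) :
  Y \subset Z -> (edge_space Y <= edge_space Z)%MS.
Proof.
move=> YZ; apply/sumsmx_subP => u uY; apply: (sumsmx_sup u) => //; exact: (subsetP YZ).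
Qed.

Lemma edge_spaceU (T : finType) (Y Z : {set T * T}) :
  (edge_space (Y :|: Z) <= edge_space Y + edge_space Z)%MS.
Proof.
apply/sumsmx_subP => u; rewrite inE => /orP[uY|uZ].
  by apply: submx_trans (addsmxSl _ _); apply: (sumsmx_sup u).
by apply: submx_trans (addsmxSr _ _); apply: (sumsmx_sup u).
Qed.

Lemma graphic_rank_mono (T : finType) : monotone (@graphic_rank T).
Proof. by move=> Y Z YZ; apply/mxrankS/edge_space_sub. Qed.

Lemma graphic_rank_submod (T : finType) : submodular (@graphic_rank T).
Proof.
move=> Y Z; rewrite -(mxrank_sum_cap (edge_space Y)); apply: leq_add; apply: mxrankS.
  exact: edge_spaceU.
by rewrite sub_capmx !edge_space_sub ?subsetIl ?subsetIr.
Qed.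

Lemma unitv_connect (T : finType) (Y : {set T * T}) x y : connect (adjI Y fst snd) x y ->
  (unitv x - unitv y <= edge_space Y)%MS.
Proof.
have one u : u \in Y -> (unitv u.1 - unitv u.2 <= edge_space Y)%MS.
  by move=> uY; apply: (sumsmx_sup u) => //; rewrite genmxE.
move=> /connectP[p]; elim: p x => [x _ ->|z p IHp x /= /andP[xz zp] ey];
  first by rewrite subrr sub0mx.
rewrite -(subrK (unitv z) (unitv x)) -addrA; apply: addmx_sub; last exact: IHp.
case/existsP: xz => u /andP[uY /orP[] /andP[/eqP <- /eqP <-]]; first exact: one.
by rewrite -opprB eqmx_opp one.
Qed.

Lemma unitv_full (T : finType) (U : 'M[rat]_#|T|) : (forall x, (unitv x <= U)%MS) -> \rank U = #|T|.
Proof.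
move=> H; apply/eqP; rewrite -/(row_full U) -sub1mx; apply/row_subP => i.
by rewrite row1; have := H (enum_val i); rewrite /unitv enum_valK.
Qed.

(** The edge vectors together with one unit vector for each component span the whole space. *)
Lemma card_le_rank_roots (T : finType) (Y : {set T * T}) :
  (#|T| <= graphic_rank Y + #|[set x | roots (adjI Y fst snd) x]|)%N.
Proof.
set R := [set x | _].
have <- : \rank (edge_space Y + \sum_(x in R) <<unitv x>>)%MS = #|T|.
  apply: unitv_full => x; set y := root (adjI Y fst snd) x.
  rewrite -(subrK (unitv y) (unitv x)); apply: addmx_sub_adds.
    by apply: unitv_connect; apply: connect_root.
  apply: (sumsmx_sup y); last by rewrite genmxE.
  by rewrite inE; apply: roots_root; apply: connect_adjI_sym.
apply: leq_trans (mxrank_adds_leqif _ _) _; rewrite leq_add2l.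
rewrite -sum1_card; elim/big_ind2: _ => [|m A k B h1 h2|x _]; first by rewrite mxrank0.
  by apply: leq_trans (mxrank_adds_leqif _ _) _; apply: leq_add.
by rewrite genmxE mxrank_delta.
Qed.

Lemma graphic_rank_connected (T : finType) (S : {set T * T}) : (forall x y, connect (adjI S fst snd) x y) ->
  (#|T| <= graphic_rank S + 1)%N.
Proof.
move=> H; apply: leq_trans (card_le_rank_roots S) _; rewrite leq_add2l.
apply/card_le1_eqP => x y; rewrite !inE => /eqP <- /eqP <-.
by apply/eqP; rewrite root_connect //; apply: connect_adjI_sym.
Qed.

(** If [y] is not reached from [x], the all-ones functional and the indicator of the component of
    [x] are independent and vanish on all edge vectors, so the rank is at most [#|T| - 2]. *)
Lemma connected_of_graphic_rank (T : finType) (S : {set T * T}) : (#|T| <= graphic_rank S + 1)%N ->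
  forall x y, connect (adjI S fst snd) x y.
Proof.
move=> H x y; apply: contraLR H => nxy; rewrite -ltnNge.
pose M : 'M[rat]_(#|T|, 1 + 1) :=
  row_mx (const_mx 1) (\col_i (connect (adjI S fst snd) x (enum_val i))%:R).
have E z : unitv z *m M = row_mx (const_mx 1) (const_mx (connect (adjI S fst snd) x z)%:R).
  rewrite /unitv -rowE; apply/rowP => j; rewrite !mxE; case: splitP => k _; rewrite !mxE //.
  by rewrite enum_rankK.
have SM : (edge_space S <= kermx M)%MS.
  apply/sumsmx_subP => u uS; rewrite genmxE; apply/sub_kermxP.
  rewrite mulmxBl !E; set b1 := connect _ _ _; set b2 := connect _ _ _.
  suff -> : b1 = b2 by rewrite subrr.
  have adj : connect (adjI S fst snd) u.1 u.2.
    by apply/connect1/existsP; exists u; rewrite uS !eqxx.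
  apply/idP/idP => h; apply: connect_trans h _ => //.
  by rewrite connect_adjI_sym.
have rM : \rank M = 2.
  apply/eqP; rewrite -/(row_full M); apply/row_fullP.
  exists (col_mx (unitv y) (unitv x - unitv y)).
  rewrite mul_col_mx mulmxBl !E connect0 (negPf nxy).
  rewrite opp_row_mx add_row_mx subrr scalar_mx_block /block_mx; congr (col_mx (row_mx _ _) (row_mx _ _));
    by apply/matrixP => i j; rewrite !mxE !ord1 ?eqxx ?subr0.
have := mxrankS SM; rewrite mxrank_ker rM -/(graphic_rank S) => h.
have n2 : (1 < #|T|)%N.
  by apply/card_gt1P; exists x, y; split => //; apply: contraNneq nxy => ->; apply: connect0.
lia.
Qed.

Lemma graphic_rank_lt (T : finType) (S : {set T * T}) : (0 < #|T|)%N -> (graphic_rank S < #|T|)%N.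
Proof.
move=> T0; pose M : 'cV[rat]_#|T| := const_mx 1.
have SM : (edge_space S <= kermx M)%MS.
  apply/sumsmx_subP => u uS; rewrite genmxE; apply/sub_kermxP.
  rewrite mulmxBl /unitv -!rowE; apply/rowP => j; rewrite !mxE; exact: subrr.
have M0 : M != 0.
  apply/eqP => /matrixP/(_ (Ordinal T0) 0); rewrite !mxE => /eqP; by rewrite oner_eq0.
have := mxrankS SM; rewrite mxrank_ker -/(graphic_rank S) => h.
have : (0 < \rank M)%N by rewrite lt0n mxrank_eq0.
lia.
Qed.

End GraphicRank.

(** * From edge-connectivity to disjoint connected sets *)

Definition cut (T : finType) (E : {set T * T}) (X : {set T}) : {set T * T} :=
  [set u in E | (u.1 \in X) != (u.2 \in X)].

Lemma cut_lower (T : finType) (e : rel T) (A : {set T}) k (X : {set T}) x y :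
  symmetric e -> (forall x y, e x y -> (x \in A) != (y \in A)) -> edge_connected k e ->
  x \in X -> y \notin X -> k <= #|cut (arcs e A) X|.
Proof.
move=> es eb ec xX yX; pose F := [set [set u.1; u.2] | u in cut (arcs e A) X].
apply: leq_trans (leq_imset_card (fun u : T * T => [set u.1; u.2]) _).
rewrite leqNgt -/F; apply/negP => /ec - /(_ _)/(_ x y) con.
have {con} /closed_connect con : connect (del_edges e F) x y.
  apply: con; apply/subsetP => _ /imsetP[u + ->].
  by rewrite !inE -andbA => /and3P[eu _ _]; apply/imsetP; exists u; rewrite ?inE.
have cl : closed (del_edges e F) (mem X).
  move=> u v /andP[euv]; apply: contraNeq => ne; apply/imsetP.
  have := eb _ _ euv; case uA: (u \in A) => /= vA.
    by exists (u, v); rewrite // !inE /= euv uA.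
  exists (v, u); last by rewrite setUC.
  by rewrite !inE /= es euv eq_sym ne andbT; move: vA; case: (v \in A).
have : (x \in X) = (y \in X) := con _ cl.
by rewrite xX (negPf yX).
Qed.

(** As soon as [Y] has two components, each has at least [k] edges in its cut, none of them in [Y],
    and an edge lies in the cuts of at most two components; hence the factor 2. Components are
    counted by their roots. *)
Lemma card_outside_rank (T : finType) (e : rel T) (A : {set T}) k (Y : {set T * T}) :
  symmetric e -> (forall x y, e x y -> (x \in A) != (y \in A)) -> edge_connected k e ->
  Y \subset arcs e A ->
  k * #|T| <= 2 * #|arcs e A :\: Y| + k * (graphic_rank Y + 1).
Proof.
move=> es eb ec YE; pose a := adjI Y fst snd; pose R := [set x | roots a x].
have acon u : u \in Y -> connect a u.1 u.2.
  by move=> uY; apply/connect1/existsP; exists u; rewrite uY !eqxx.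
have asym : connect_sym a := connect_adjI_sym _ _ _.
have [R1|R2] := leqP #|R| 1.
  apply: leq_trans (leq_addl _ _); rewrite leq_mul2l; apply/orP; right.
  by apply: leq_trans (card_le_rank_roots Y) _; rewrite leq_add2l.
have big : k * #|R| <= 2 * #|arcs e A :\: Y|.
  pose K x := [set y | connect a x y].
  have -> : k * #|R| = \sum_(x in R) k by rewrite sum_nat_const mulnC.
  apply: (@leq_trans (\sum_(x in R) #|cut (arcs e A) (K x)|)).
    apply: leq_sum => x xR.
    have [y yR yx] : exists2 y, y \in R & y != x.
      by move: R2; rewrite (cardsD1 x) xR ltnS card_gt0 => /set0Pn[y]; rewrite !inE => /andP[? ?];
         exists y; rewrite ?inE.
    apply: (@cut_lower _ _ _ _ _ x y) => //; rewrite !inE ?connect0 //.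
    rewrite -(root_connect asym); apply: contra yx.
    by move: xR yR; rewrite !inE /roots => /eqP-> /eqP->; rewrite eq_sym.
  rewrite mulnC -sum_nat_const.
  under eq_bigr => x _ do rewrite -sum1_card.
  rewrite (exchange_big_dep (mem (arcs e A :\: Y))) /=; last first.
    move=> x u _; rewrite !inE -andbA => /and3P[-> -> ne]; rewrite !andbT.
    apply: contra ne => /acon cu; apply/eqP; apply/idP/idP => h; apply: connect_trans h _ => //.
    by rewrite asym.
  apply: leq_sum => u _; rewrite sum1_card.
  apply: leq_trans (_ : #|[set root a u.1; root a u.2]| <= _).
    apply/subset_leq_card/subsetP => x; rewrite inE => /andP[xR].
    have /eqP xr : roots a x by move: xR; rewrite inE.
    rewrite [u \in _]inE => /andP[_]; rewrite !inE -!(root_connect asym) xr.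
    by case: (x == _); case: (x == _).
  by rewrite cards2; case: (_ != _).
apply: leq_trans (_ : k * (graphic_rank Y + #|R|) <= _).
  by rewrite leq_mul2l card_le_rank_roots orbT.
by rewrite !mulnDr muln1; move: big; lia.
Qed.

Lemma grouping (X V : finType) (H : {set X}) (s : X -> V) g : 0 < g ->
  exists (I : finType) (G : X -> I) (w : I -> V), [/\ forall u, w (G u) = s u,
    forall i, #|fib H G i| <= g &
    forall v, #|G @: fib H s v| <= (#|fib H s v| + g.-1) %/ g].
Proof.
move=> g0; pose idx u := index u (enum (fib H s (s u))).
have idxX u : idx u %/ g < #|X|.+1.
  rewrite ltnS; apply: leq_trans (leq_div _ _) _; apply: leq_trans (index_size _ _) _.
  by rewrite -cardE; apply: max_card.
exists (V * 'I_#|X|.+1)%type, (fun u => (s u, inord (idx u %/ g))), fst; split => // [i|v].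
  rewrite -[g in _ <= g](card_ord g).
  have lt n : n %% g < g by apply: ltn_pmod.
  apply: (@leq_card_in _ _ (fun u => Ordinal (lt (idx u)))) => // u u'.
  rewrite !in_fib => /andP[uH /eqP ui] /andP[uH' /eqP ui'] [emod].
  move: ui'; rewrite -ui => -[es] /(congr1 val); rewrite /= !inordK // => ediv.
  have ei : idx u = idx u' by rewrite (divn_eq (idx u) g) -ediv emod -divn_eq.
  have m : u \in enum (fib H s (s u)) by rewrite mem_enum in_fib uH eqxx.
  have m' : u' \in enum (fib H s (s u)) by rewrite mem_enum in_fib uH' es eqxx.
  by rewrite -(nth_index u m) -[RHS](nth_index u m') -/(idx u) ei /idx es.
set d := #|fib H s v|; set N := _ %/ _.
rewrite -[N]card_ord -(cardsT 'I_N).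
apply: leq_trans (leq_imset_card (fun j : 'I_N => (v, inord j)) _).
apply/subset_leq_card/subsetP => _ /imsetP[u + ->]; rewrite in_fib => /andP[uH /eqP uv].
have iN : idx u %/ g < N.
  have id : idx u < d.
    by rewrite /d cardE /idx uv index_mem mem_enum in_fib uH uv eqxx.
  rewrite /N; have -> : d + g.-1 = d.-1 + 1 * g by lia.
  by rewrite divnDMl // addn1 ltnS; apply: leq_div2r; lia.
by apply/imsetP; exists (Ordinal iN); rewrite // uv.
Qed.

Lemma card_le_graphic_rank (T : finType) (S : {set T * T}) : graphic_rank S <= #|S|.
Proof.
rewrite /graphic_rank /edge_space -sum1_card; elim/big_ind2: _ => [|m A k B h1 h2|x _].
- by rewrite mxrank0.
- by apply: leq_trans (mxrank_adds_leqif _ _) _; apply: leq_add.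
- by rewrite genmxE rank_leq_row.
Qed.

(** Adding an edge raises the rank by at most one. This is toughness 1 of a connected set. *)
Lemma connected_outside_rank (T : finType) (S Y : {set T * T}) :
  (forall x y, connect (adjI S fst snd) x y) -> #|T| <= #|S :\: Y| + (graphic_rank Y + 1).
Proof.
move=> /graphic_rank_connected h; apply: leq_trans h _; rewrite addnA leq_add2r.
apply: leq_trans (_ : graphic_rank ((S :\: Y) :|: Y) <= _).
  apply: graphic_rank_mono; apply/subsetP => u uS; rewrite !inE uS andbT.
  by case: (u \in Y).
apply: leq_trans (leq_addr (graphic_rank ((S :\: Y) :&: Y)) _) _.
apply: leq_trans (graphic_rank_submod _ _) _; rewrite leq_add2r.
exact: card_le_graphic_rank.
Qed.

(* The rank of Y is #|T| minus the number of components of Y, so H has at least c edges outside Y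
   for each component but one. *)
Definition tough (T : finType) (c : nat) (H : {set T * T}) :=
  forall Y : {set T * T}, Y \subset H -> c * #|T| <= #|H :\: Y| + c * (graphic_rank Y + 1).

(** Toughness adds up over disjoint connected sets, so the sets produced by one thinning can be
    united and thinned again at the other side. *)
Lemma tough_bigcup (T : finType) k (S : 'I_k -> {set T * T}) (P : pred 'I_k) :
  (forall i x y, connect (adjI (S i) fst snd) x y) ->
  (forall i j, i != j -> [disjoint S i & S j]) ->
  tough #|P| (\bigcup_(i | P i) S i).
Proof.
move=> Sc Sd Y _.
pose F i := if P i then S i :\: Y else set0.
have -> : #|\bigcup_(i | P i) S i :\: Y| = \sum_(i | P i) #|S i :\: Y|.
  have -> : \bigcup_(i | P i) S i :\: Y = \bigcup_i F i.
    apply/setP => u; rewrite inE; apply/andP/bigcupP => [[uY /bigcupP[i Pi ui]]|[i _]].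
      by exists i; rewrite // /F Pi inE uY.
    rewrite /F; case: ifP => Pi; rewrite inE // => /andP[uY ui]; split => //.
    by apply/bigcupP; exists i.
  rewrite -sum1_card partition_disjoint_bigcup; last first.
    move=> i j ij; have := Sd i j ij; rewrite -!setI_eq0 -!subset0 => d.
    apply: subset_trans d; apply: setISS; rewrite /F; case: ifP => _; rewrite ?sub0set //;
      exact: subsetDl.
  rewrite [RHS]big_mkcond; apply: eq_bigr => i _; rewrite sum1_card /F.
  by case: ifP => _; rewrite ?cards0.
rewrite -sum1_card !big_distrl -big_split; apply: leq_sum => i _ /=.
by rewrite !mul1n; apply: connected_outside_rank.
Qed.

(* Keep one edge from every group of at most g edges at a vertex of the side s; Rado's theorem
   for the union of k graphic matroids gives the choice. *)
Lemma thinning (T : finType) (H : {set T * T}) (s : T * T -> T) c g k :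
  0 < g -> 0 < #|T| -> k * g <= c -> tough c H ->
  exists S : 'I_k -> {set T * T}, [/\ forall i, S i \subset H,
    forall i x y, connect (adjI (S i) fst snd) x y,
    forall i j, i != j -> [disjoint S i & S j] &
    forall v, \sum_i #|fib (S i) s v| <= (#|fib H s v| + g.-1) %/ g].
Proof.
move=> g0 T0 kgc tH; have [I [G [w [wG Gg Gdeg]]]] := grouping H s g0.
(* An element of the ground set is an edge together with the index of the connected set that
   receives it; [f] adds up the graphic ranks of the [k] slices. *)
pose sl (W : {set (T * T) * 'I_k}) j := [set u | (u, j) \in W].
pose f W := \sum_j graphic_rank (sl W j).
have fm : monotone f.
  move=> Y Z YZ; apply: leq_sum => j _; apply: graphic_rank_mono.
  by apply/subsetP => u; rewrite !inE; apply: (subsetP YZ).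
have fs : submodular f.
  move=> Y Z; rewrite /f -!big_split; apply: leq_sum => j _ /=.
  have -> : sl (Y :|: Z) j = sl Y j :|: sl Z j by apply/setP => u; rewrite !inE.
  have -> : sl (Y :&: Z) j = sl Y j :&: sl Z j by apply/setP => u; rewrite !inE.
  exact: graphic_rank_submod.
pose A i := setX (fib H G i) [set: 'I_k].
have [k0|k0] := posnP k.
  exists (fun=> set0); split => [i|i|i|v]; try by move: (i); rewrite k0 => -[].
  by rewrite big1 // => i; move: (i); rewrite k0 => -[].
have [x0 _] : exists x0 : T, x0 \in T by apply/card_gt0P.
have [|J JD|x xA px] := rado_choice (D := G @: H) (A := A) (p := k * #|T|.-1) ((x0, x0), Ordinal k0) fm fs.
- move=> _ /imsetP[u uH ->]; apply/set0Pn; exists (u, Ordinal k0).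
  by rewrite !inE uH eqxx.
- pose Y := [set u in H | G u \in J].
  have h1 : k * graphic_rank Y <= f (\bigcup_(i in J) A i).
    have -> : k * graphic_rank Y = \sum_(j < k) graphic_rank Y by rewrite sum_nat_const card_ord.
    apply: leq_sum => j _; apply: graphic_rank_mono; apply/subsetP => u.
    rewrite !inE => /andP[uH uJ]; apply/bigcupP; exists (G u) => //.
    by rewrite !inE uH eqxx.
  have h2 : #|H :\: Y| <= #|G @: H :\: J| * g.
    rewrite (card_fibs _ G) -sum_nat_const [X in _ <= X]big_mkcond; apply: leq_sum => i _.
    have [iD|iD] := boolP (i \in _).
      apply: leq_trans (Gg i); apply/subset_leq_card/subsetP => u.
      by rewrite !in_fib inE => /andP[/andP[_ ->]].
    rewrite leqn0 cards_eq0 -subset0; apply/subsetP => u.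
    rewrite in_fib !inE => /andP[/andP[+ uH] /eqP ui].
    move: iD; rewrite uH inE -ui imset_f // andbT negbK => ->.
    by [].
  have h3 : #|J| + #|G @: H :\: J| = #|G @: H|.
    by rewrite -(cardsID J (G @: H)) (setIidPr JD).
  have h4 := tH Y _; have h5 := graphic_rank_lt Y T0.
  have YH : Y \subset H by apply/subsetP => u; rewrite inE => /andP[].
  move: {h4}(h4 YH) => h4.
  (* With [m] the number of components of [Y] minus one, toughness gives [c * m] edges outside [Y].
     A group has at most [g] edges and [k * g <= c], so at least [k * m] groups lie outside [J]. *)
  have h6 : k * #|T|.-1 <= k * graphic_rank Y + #|G @: H :\: J|.
    move: h4 h5 h2; move: (graphic_rank Y) #|G @: H :\: J| #|H :\: Y| => r d h h4 h5 h2.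
    have [m em] : exists m, #|T| = r + 1 + m by exists (#|T| - r.+1); lia.
    rewrite em !mulnDr in h4 *.
    have h7 : k * g * m <= d * g.
      apply: leq_trans h2; apply: leq_trans (_ : c * m <= h); last by lia.
      by rewrite leq_mul2r kgc orbT.
    have h8 : k * m <= d by rewrite -(leq_pmul2r g0); lia.
    have -> : (r + 1 + m).-1 = r + m by lia.
    by rewrite mulnDr leq_add2l.
  rewrite -h3 addnCA leq_add2l; apply: leq_trans h6 _; by rewrite leq_add2r.
exists (sl [set x i | i in G @: H]).
have inS u j : (u, j) \in [set x i | i in G @: H] -> u \in H /\ x (G u) = (u, j).
  case/imsetP => i iD ex; have := xA i iD; rewrite -ex !inE andbT => /andP[uH /eqP ->].
  by [].
split => [j|j|i j ij|v].
- by apply/subsetP => u; rewrite inE => /inS[].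
(* The [k] ranks add up to at least [k * #|T|.-1] and none exceeds [#|T|.-1], so each is maximal. *)
- apply: connected_of_graphic_rank; rewrite leqNgt; apply/negP => lt.
  move: px; rewrite leqNgt => /negP; apply; rewrite /f (bigD1 j) //=.
  apply: leq_ltn_trans (_ : _ <= graphic_rank (sl [set x i | i in G @: H] j) + k.-1 * #|T|.-1) _.
    rewrite leq_add2l -[k in k.-1]card_ord -(cardC1 j) -sum_nat_const; apply: leq_sum => i _.
    by rewrite -ltnS prednK // graphic_rank_lt.
  by rewrite -[k in _ < k * _](prednK k0) mulSn ltn_add2r -ltnS prednK // -addn1.
- rewrite -setI_eq0; apply/eqP/setP => u; rewrite !inE; apply/andP => -[/inS[_ e1] /inS[_ e2]].
  by move: e2; rewrite e1 => -[e]; rewrite e eqxx in ij.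
- apply: leq_trans (Gdeg v); apply: leq_trans (leq_imset_card x _).
  rewrite (card_fibs _ snd); apply: leq_sum => j _.
  rewrite -(card_imset _ (_ : injective (fun u => (u, j)))); last by move=> ? ? [].
  apply/subset_leq_card/subsetP => _ /imsetP[u + ->]; rewrite !in_fib inE => /andP[uj /eqP us].
  rewrite eqxx andbT; have [uH <-] := inS _ _ uj.
  by apply: imset_f; apply: imset_f; rewrite in_fib uH us eqxx.
Qed.

(** A Hall type argument: each [b] in [S] asks for [k] edges, and [#|G @: Y|] is the rank of a
    partition matroid. The edges at [n] vertices of [S] number at least [n * k * g], so they meet at
    least [n * k] groups. *)
Lemma balanced_picks (X V W : finType) (R : {set X}) (tb : X -> V) (ta : X -> W)
    (S : {set V}) g k :
  0 < g -> (forall b, b \in S -> k * g <= #|fib R tb b|) ->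
  exists P : {set X}, [/\ P \subset R, forall b, b \in S -> k <= #|fib P tb b| &
    forall a, #|fib P ta a| <= (#|fib R ta a| + g.-1) %/ g].
Proof.
move=> g0 deg; have [I [G [w [wG Gg Gdeg]]]] := grouping R ta g0.
pose D := setX S [set: 'I_k].
have [D0|/set0Pn[[b0 j0]]] := eqVneq D set0.
  exists set0; split => [|b bS|a]; first exact: sub0set; last by rewrite fib_set0 cards0.
  have : #|D| = 0 by rewrite D0 cards0.
  rewrite cardsX cardsT card_ord => /eqP; rewrite muln_eq0 cards_eq0.
  by case/orP => /eqP k0; [rewrite k0 inE in bS | rewrite k0].
rewrite !inE andbT => b0S; have k0 : 0 < k by apply: leq_ltn_trans (ltn_ord j0).
have /card_gt0P[x0 _] : 0 < #|fib R tb b0|.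
  by apply: leq_trans (deg b0 b0S); rewrite muln_gt0 k0.
pose f (Y : {set X}) := #|G @: Y|.
have fm : monotone f by move=> Y Z YZ; apply/subset_leq_card/imsetS.
have fs : submodular f.
  move=> Y Z; rewrite /f imsetU -(cardsUI (G @: Y)) leq_add2l.
  by apply/subset_leq_card/subsetP => _ /imsetP[u + ->]; rewrite !inE => /andP[? ?]; rewrite !imset_f.
pose A (d : V * 'I_k) := fib R tb d.1.
have [|J JD|x xA px] := rado_choice (D := D) (A := A) (p := #|D|) x0 fm fs.
- move=> [b j]; rewrite !inE andbT -card_gt0 => bS.
  by apply: leq_trans (deg b bS); rewrite muln_gt0 k0.
- rewrite leq_add2r; set Y := \bigcup_(i in J) A i; pose K := fst @: J.
  have KS b : b \in K -> b \in S.
    by case/imsetP => -[b' j] /(subsetP JD); rewrite !inE andbT => ? ->.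
  have h1 : #|J| <= #|K| * k.
    rewrite -[k in _ * k]card_ord -cardsT -cardsX; apply/subset_leq_card/subsetP => -[b j] bj.
    by rewrite !inE andbT; apply/imsetP; exists (b, j).
  have h2 : #|K| * (k * g) <= #|Y|.
    rewrite (card_fibs _ tb) -sum_nat_const [X in X <= _]big_mkcond; apply: leq_sum => b _.
    have [bK|//] := boolP (b \in _); apply: leq_trans (deg b (KS b bK)) _.
    apply/subset_leq_card/subsetP => u; rewrite !in_fib => /andP[uR /eqP ub].
    rewrite ub eqxx andbT; move: bK => /imsetP[d dJ bd]; apply/bigcupP; exists d => //.
    by rewrite in_fib uR ub bd /=.
  have h3 : #|Y| <= #|G @: Y| * g.
    rewrite (card_fibs _ G) -sum_nat_const [X in _ <= X]big_mkcond; apply: leq_sum => i _.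
    have [iD|iD] := boolP (i \in _).
      apply: leq_trans (Gg i); apply/subset_leq_card/subsetP => u.
      rewrite !in_fib => /andP[/bigcupP[d _] + ->]; rewrite in_fib => /andP[->] //.
    rewrite leqn0 cards_eq0 -subset0; apply/subsetP => u.
    by rewrite in_fib => /andP[uY /eqP ui]; rewrite -ui imset_f in iD.
  apply: leq_trans h1 _; rewrite -(leq_pmul2r g0) -mulnA; exact: leq_trans h2 h3.
pose P := [set x d | d in D].
have c1 : #|P| <= #|D| := leq_imset_card _ _.
have c2 : f P <= #|P| := leq_imset_card _ _.
(* The rank of [P] attains [#|D|], so the chosen edges are distinct and lie in distinct groups. *)
have Ginj : {in P &, injective G}.
  by apply/imset_injP; apply/eqP/anti_leq; rewrite c2 (leq_trans c1).
have xinj : {in D &, injective x}.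
  by apply/imset_injP; apply/eqP/anti_leq; rewrite c1 (leq_trans px).
exists P; split => [|b bS|a].
- by apply/subsetP => _ /imsetP[d dD ->]; have := xA d dD; rewrite in_fib => /andP[].
- rewrite -[k in k <= _]card_ord -(card_in_imset (f := fun j => x (b, j))); last first.
    by move=> j j' _ _ /xinj; rewrite !inE /= bS => /(_ isT isT)[].
  apply/subset_leq_card/subsetP => _ /imsetP[j _ ->].
  have bD : (b, j) \in D by rewrite !inE bS.
  have := xA _ bD; rewrite !in_fib imset_f // => /andP[_]; by [].
- apply: leq_trans (Gdeg a); rewrite -(card_in_imset (f := G)); last first.
    by move=> u u'; rewrite !in_fib => /andP[uP _] /andP[uP' _]; apply: Ginj.
  apply/subset_leq_card/imsetS/subsetP => u; rewrite !in_fib => /andP[/imsetP[d dD ->] ->].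
  by have := xA d dD; rewrite in_fib => /andP[->].
Qed.

(** * Halving even edge sets *)

Lemma card_half (X : finType) (K : {set X}) (f : X -> X) (c : X -> bool) :
  involutive f -> (forall x, x \in K -> f x \in K /\ c (f x) = ~~ c x) ->
  #|K| = 2 * #|[set x in K | c x]|.
Proof.
move=> ff fK; rewrite -(cardsID [set x | c x] K) mul2n -addnn.
have -> : K :&: [set x | c x] = [set x in K | c x] by apply/setP => x; rewrite !inE.
congr (_ + _); rewrite -(card_imset _ (inv_inj ff)); apply: eq_card => y; rewrite !inE.
apply/imsetP/andP => [[x]|[yK cy]].
  by rewrite !inE => /andP[cx xK] ->; have [-> ->] := fK x xK.
by have [fy cfy] := fK y yK; exists (f y); rewrite ?ff // !inE fy cfy cy.
Qed.

Lemma pairing_half (X V : finType) (D : {set X}) (k : X -> V) f (c : X -> bool) v :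
  pairing D k f -> (forall x, x \in D -> c (f x) = ~~ c x) ->
  #|fib D k v| = 2 * #|fib [set x in D | c x] k v|.
Proof.
move=> [ff _ fD kf] cf; rewrite (card_half (f := f) (c := c) ff) => [|x].
  by congr (2 * _); apply: eq_card => x; rewrite !inE andbAC.
by rewrite !in_fib kf => /andP[xD ->]; have [-> _] := fD x xD; rewrite cf.
Qed.

Lemma exact_half (X V W : finType) (D : {set X}) (ka : X -> V) (kb : X -> W) :
  (forall v, ~~ odd #|fib D ka v|) -> (forall v, ~~ odd #|fib D kb v|) ->
  exists H : {set X}, [/\ H \subset D, forall v, #|fib D ka v| = 2 * #|fib H ka v| &
    forall v, #|fib D kb v| = 2 * #|fib H kb v|].
Proof.
move=> /pairing_exists[f pf] /pairing_exists[g pg].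
have [c cP] := bicolor pf pg; exists [set x in D | c x]; split => [|v|v].
- by apply/subsetP => x; rewrite inE => /andP[].
- by apply: pairing_half pf _ => x /cP[].
- by apply: pairing_half pg _ => x /cP[].
Qed.

(* Start from the alternating half P of closed trails covering D, and let the passage i in P stand
   for the trail segment from i to f i. Exchanging i and f i moves the half at the two
   visits i and g (f i), so a T-join among visits with one special visit at each vertex of
   wrong parity corrects all parities and moves every vertex by at most one. *)
Lemma balanced_half (X V W : finType) (D : {set X}) (ka : X -> V) (kb : X -> W) (O : {set W}) :
  (forall v, ~~ odd #|fib D ka v|) -> (forall v, ~~ odd #|fib D kb v|) ->
  O \subset kb @: D ->
  (forall K : {set X}, K \subset D ->
    (forall x y, x \in K -> y \in D -> ka x = ka y \/ kb x = kb y -> y \in K) ->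
    odd (#|K| %/ 2) = odd #|O :&: kb @: K|) ->
  exists H : {set X}, [/\ H \subset D, forall v, #|fib D ka v| = 2 * #|fib H ka v| &
    forall v, [/\ odd #|fib H kb v| = (v \in O), 2 * #|fib H kb v| <= #|fib D kb v| + 2
      & #|fib D kb v| <= 2 * #|fib H kb v| + 2]].
Proof.
move=> eva evb Osub comp; have [f [g [pf pg con]]] := transitions_exist eva evb.
have [ff _ fD kf] := pf; have [gg _ gD kg] := pg.
have [c cP] := bicolor pf pg.
have cf x : x \in D -> c (f x) = ~~ c x by move=> /cP[].
have cg x : x \in D -> c (g x) = ~~ c x by move=> /cP[].
pose P := [set x in D | c x].
have PD x : x \in P -> x \in D by rewrite inE => /andP[].
have gfP x : x \in P -> g (f x) \in P.
  rewrite !inE => /andP[xD cx]; have [fxD _] := fD x xD; have [-> _] := gD _ fxD.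
  by rewrite cg // cf // cx.
pose wrong := [set v | odd #|fib P kb v| (+) (v \in O)].
have wrongP v : v \in wrong -> exists x, x \in fib P kb v.
  move=> vw; have [e|/set0Pn[x xv]] := eqVneq (fib P kb v) set0; last by exists x.
  move: vw; rewrite inE e cards0 /= => /(subsetP Osub) /imsetP[x xD xv].
  have [cx|ncx] := boolP (c x); first by exists x; rewrite -e !inE xD cx xv eqxx.
  by have [gxD _] := gD x xD; exists (g x); rewrite -e !inE gxD cg // ncx kg xv eqxx.
have wrongE v : (v \in wrong) = odd #|fib P kb v| (+) (v \in O) by rewrite inE.
clearbody wrong.
have special v : exists o : option X, if v \in wrong then
    exists2 x, o = Some x & x \in fib P kb v else o = None.
  by have [/wrongP[x xv]|_] := boolP (v \in wrong); [exists (Some x), x | exists None].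
have [s sP] := fin_all_exists special.
pose S := [set x | (kb x \in wrong) && (s (kb x) == Some x)].
have SP x : x \in S -> x \in P.
  rewrite inE => /andP[w /eqP e]; have := sP (kb x); rewrite w e => -[_ [<-]].
  by rewrite in_fib => /andP[].
have Scard v : #|fib S kb v| = (v \in wrong).
  have := sP v; have [w [x sx xv]|w sn] := boolP (v \in wrong).
    apply/eqP/cards1P; exists x; apply/setP => y; rewrite in_fib [y \in S]inE [RHS]inE.
    move: xv; rewrite in_fib => /andP[_ /eqP xv].
    apply/andP/eqP => [[/andP[_ /eqP e] /eqP yv]|->]; last by rewrite xv w sx eqxx.
    by move: e; rewrite yv sx => -[].
  apply/eqP; rewrite cards_eq0 -subset0; apply/subsetP => y; rewrite in_fib [y \in S]inE -andbA => /and3P[yw _ /eqP yv].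
  by rewrite -yv yw in w.
pose a := adjI P id (g \o f).
have a_step x y : a x y -> connect (step2 f g) x y.
  have st z : connect (step2 f g) z (g (f z)).
    by apply: connect_trans (connect_step2_l f g z) (connect_step2_r f g _).
  case/exists_inP => i iP /orP[] /andP[/eqP <- /eqP <-] //=.
  by rewrite (connect_step2_sym ff gg); apply: st.
have a_P x y : connect a x y -> x = y \/ x \in P /\ y \in P.
  case/connectP => p; elim: p x => [x _ ->|z p IHp x /= /andP[xz zp] ey]; first by left.
  have [xP zP] : x \in P /\ z \in P.
    by case/exists_inP: xz => i iP /orP[] /andP[/eqP <- /eqP <-]; rewrite gfP.
  by right; case: (IHp z zp ey) => [<-|[]].
(* Every visit on the [kb] side pairs one edge of [P] with one outside, so [P] also indexes the
   visits; [v x] is the visit that uses [x]. *)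
pose v x := if c x then x else g x.
have connect_v x y : x \in D -> connect (step2 f g) x y -> connect a (v x) (v y).
  move=> xD /connectP[p]; elim: p x xD => [x _ _ ->|z p IHp x xD /= /andP[xz zp] ey].
    exact: connect0.
  have [fxD _] := fD x xD; have [gxD _] := gD x xD.
  case/orP: xz zp ey => /eqP -> zp ey; last first.
    apply: connect_trans (IHp _ gxD zp ey); rewrite /v cg // gg.
    by case: (c x).
  apply: connect_trans (IHp _ fxD zp ey); rewrite /v cf //.
  case cx: (c x) => /=.
    by apply/connect1/exists_inP; exists x; rewrite ?inE ?xD ?cx ?eqxx.
  rewrite connect_adjI_sym; apply/connect1/exists_inP; exists (f x).
    by rewrite !inE fxD cf // cx.
  by rewrite /= ff !eqxx.
have vP x : x \in P -> v x = x by rewrite inE /v => /andP[_ ->].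
have Seven x : ~~ odd #|[set y in S | connect a x y]|.
  have [xP|xP] := boolP (x \in P); last first.
    suff -> : [set y in S | connect a x y] = set0 by rewrite cards0.
    apply/setP => y; rewrite !inE; apply/negbTE/negP => /andP[/andP[yw ys] /a_P[e|[xP' _]]].
      by case/negP: xP; apply: SP; rewrite inE e yw ys.
    by rewrite xP' in xP.
  pose K := [set y in D | connect (step2 f g) x y].
  have KD : K \subset D by apply/subsetP => y; rewrite inE => /andP[].
  have Kcl y z : y \in K -> z \in D -> ka y = ka z \/ kb y = kb z -> z \in K.
    rewrite !inE => /andP[yD xy] zD yz; rewrite zD; apply: connect_trans xy _.
    exact: con.
  have -> : [set y in S | connect a x y] = S :&: K.
    apply/setP => y; rewrite [LHS]inE [RHS]inE; apply: andb_id2l => /SP yP.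
    rewrite inE (PD _ yP); apply/idP/idP => h; first exact: connect_mono a_step _ _ h.
    by rewrite -(vP x xP) -(vP y yP); apply: connect_v; rewrite // PD.
  have -> : #|S :&: K| = #|wrong :&: kb @: K|.
    rewrite (card_fibs _ kb) -sum1_card [RHS]big_mkcond; apply: eq_bigr => w _.
    rewrite inE -[RHS]/(nat_of_bool (_ && _)).
    have [wK|wK] := boolP (w \in kb @: K); last first.
      rewrite andbF; apply/eqP; rewrite cards_eq0 -subset0; apply/subsetP => y.
      rewrite in_fib => /andP[/setIP[_ yK] /eqP yw]; case/negP: wK; rewrite -yw.
      exact: imset_f.
    rewrite andbT -Scard; apply: eq_card => y; rewrite !in_fib [y \in S :&: K]inE.
    apply: andb_id2r => /eqP yw; have [yS|//] := boolP (y \in S).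
    by case/imsetP: wK => z zK zw; rewrite (Kcl z y) // ?PD ?SP //; right; rewrite -zw.
  have Keven : #|K| = 2 * #|[set y in K | c y]|.
    apply: (card_half (f := f) (c := c) ff) => y; rewrite !inE => /andP[yD xy].
    have [-> _] := fD y yD; rewrite cf //; split => //.
    exact: connect_trans xy (connect_step2_l f g y).
  have := comp K KD Kcl; rewrite Keven mulKn // => e.
  (* Summing the definition of [wrong] over the vertices met by [K] gives the parity of the
     alternating half of [K] plus that of [O] on [K]; [comp] makes the two equal. *)
  suff -> : odd #|wrong :&: kb @: K| = odd #|[set y in K | c y]| (+) odd #|O :&: kb @: K|.
    by rewrite e addbb.
  rewrite (card_fibs _ kb) (big_morph odd oddD (erefl _)) !odd_card_addb -big_split /=.
  apply: eq_bigr => w _; rewrite !inE wrongE.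
  have [wK|wK] := boolP (w \in kb @: K); last first.
    rewrite !andbF addbF (_ : fib _ _ _ = set0) ?cards0 //; apply/setP => y.
    rewrite !inE; apply: contraNF wK => /andP[/andP[yK _] /eqP <-].
    by apply/imsetP; exists y; rewrite // inE.
  rewrite !andbT; congr (odd _ (+) _); apply: eq_card => y; rewrite !in_fib !inE.
  case/imsetP: wK => z zK zw.
  have [/eqP yw|] := boolP (kb y == w); last by rewrite !andbF.
  have [yD|//] := boolP (y \in D).
  have := Kcl z y zK yD; rewrite -zw yw inE yD /= => -> //; by right.
have [J JP Jodd] := Tjoin Seven.
have fJ x : x \in J -> f x \notin P.
  move=> /(subsetP JP); rewrite !inE => /andP[xD cx]; have [-> _] := fD x xD.
  by rewrite cf // cx.
pose H := (P :\: J) :|: f @: J.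
have cardH (Z : finType) (k : X -> Z) z :
    #|fib H k z| + #|fib J k z| = #|fib P k z| + #|fib (f @: J) k z|.
  have -> : fib H k z = (fib P k z :\: fib J k z) :|: fib (f @: J) k z.
    by apply/setP => x; rewrite !in_fib !inE !andb_orl; case: (k x == z); rewrite ?andbT ?andbF.
  rewrite cardsU (_ : _ :&: _ = set0) ?cards0 ?subn0.
    rewrite cardsD (setIidPr _); last by apply/subsetP => x; rewrite !in_fib => /andP[/(subsetP JP) -> ->].
    have : #|fib J k z| <= #|fib P k z|.
      by apply/subset_leq_card/subsetP => x; rewrite !in_fib => /andP[/(subsetP JP) -> ->].
    by lia.
  apply/setP => x; rewrite [LHS]inE [RHS]inE; apply/negP => /andP[/setDP[+ _]].
  rewrite !in_fib => /andP[xP _] /andP[/imsetP[y yJ e] _].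
  by case/negP: (fJ y yJ); rewrite -e.
have fimg (Z : finType) (k : X -> Z) z : #|fib (f @: J) k z| = #|fib J (k \o f) z|.
  rewrite -[RHS](card_imset _ (inv_inj ff)); apply: eq_card => x; rewrite in_fib.
  apply/andP/imsetP => [[/imsetP[y yJ ->] kz]|[y + ->]]; first by exists y; rewrite // in_fib yJ.
  by rewrite in_fib => /andP[yJ ->]; rewrite imset_f.
exists H; split => [|w|w].
- apply/subsetP => x /setUP[/setDP[/PD //]|/imsetP[y /(subsetP JP)/PD yD ->]].
  by have [] := fD y yD.
- have := cardH _ ka w; rewrite fimg.
  have -> : fib J (ka \o f) w = fib J ka w by apply/setP => x; rewrite !in_fib /= kf.
  by move=> /addIn ->; apply: pairing_half pf cf.
- have hP := pairing_half w pg cg; rewrite -/P in hP.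
  have hH := cardH _ kb w; rewrite fimg in hH.
  pose J' := (g \o f) @: J.
  have eJ' : #|fib J (kb \o f) w| = #|fib J' kb w|.
    rewrite -[LHS](card_imset _ (walk_inj pf pg)); apply: eq_card => x; rewrite in_fib.
    apply/imsetP/andP => [[y + ->]|[/imsetP[y yJ ->] kz]].
      by rewrite in_fib => /andP[yJ yw]; rewrite imset_f //= kg.
    by exists y; rewrite // in_fib yJ; move: kz; rewrite /= kg.
  (* [J'] is [J] moved to the other ends of its segments. As [S] has at most one element at a
     vertex, the counts of [J] and [J'] there differ by at most one, and so do those of [H] and
     [P]. *)
  have SJ : S = symdiff J J'.
    apply/setP => x; rewrite -Jodd inE /odd_at; congr (_ (+) _).
      rewrite (_ : fib J id x = if x \in J then [set x] else set0); last first.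
        by apply/setP => y; rewrite in_fib; case: ifP => xJ; rewrite inE; case: eqP => [->|]; rewrite ?xJ ?andbF.
      by case: ifP; rewrite ?cards1 ?cards0.
    have [/imsetP[y yJ ->]|xJ] := boolP (x \in J').
      rewrite (_ : fib _ _ _ = [set y]) ?cards1 //; apply/setP => z.
      rewrite in_fib inE (inj_eq (walk_inj pf pg)); case: eqP => [->|]; rewrite ?yJ ?andbF //.
    rewrite (_ : fib _ _ _ = set0) ?cards0 //; apply/setP => z; rewrite in_fib inE.
    by apply: contraNF xJ => /andP[zJ /eqP <-]; apply: imset_f.
  have sc := Scard w; rewrite SJ fib_symdiff in sc.
  have pc := odd_symdiff (fib J kb w) (fib J' kb w); rewrite sc oddb in pc.
  have sub1 : #|fib J kb w| <= #|fib J' kb w| + 1.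
    apply: leq_trans (_ : #|symdiff (fib J kb w) (fib J' kb w) :|: fib J' kb w| <= _).
      apply/subset_leq_card/subsetP => x; rewrite !inE => /andP[-> ->].
      by case: (x \in J').
    by apply: leq_trans (leq_card_setU _ _) _; rewrite sc addnC leq_add2l leq_b1.
  have sub2 : #|fib J' kb w| <= #|fib J kb w| + 1.
    apply: leq_trans (_ : #|symdiff (fib J kb w) (fib J' kb w) :|: fib J kb w| <= _).
      apply/subset_leq_card/subsetP => x; rewrite !inE => /andP[-> ->].
      by case: (x \in J).
    by apply: leq_trans (leq_card_setU _ _) _; rewrite sc addnC leq_add2l leq_b1.
  move: pc; rewrite wrongE => pc; rewrite eJ' in hH.
  have hodd := congr1 odd hH; rewrite !oddD in hodd.
  split; [|by lia..].
  move: hodd pc; case: (odd _); case: (odd _); case: (odd _); case: (odd _); case: (w \in O) => //.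
Qed.

Lemma card_between (X : finType) (A B : {set X}) n :
  A \subset B -> #|A| <= n <= #|B| -> exists S : {set X}, [/\ A \subset S, S \subset B & #|S| = n].
Proof.
move=> AB /andP[An]; elim: n An => [|n IHn] An nB.
  by exists A; split => //; apply/eqP; rewrite -leqn0.
move: An; rewrite leq_eqVlt => /orP[/eqP <-|An]; first by exists A.
have [||S [AS SB Sn]] := IHn; [exact: An|exact: ltnW|].
have [x] : exists x, x \in B :\: S.
  by apply/set0Pn; rewrite -card_gt0 cardsD (setIidPr SB) Sn subn_gt0.
rewrite inE => /andP[xS xB]; exists (x |: S); split.
- exact: subset_trans AS (subsetUr _ _).
- by rewrite subUset sub1set xB.
- by rewrite cardsU1 xS Sn.
Qed.

Lemma fibS (X V : finType) (A B : {set X}) (k : X -> V) v :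
  A \subset B -> fib A k v \subset fib B k v.
Proof. by move=> AB; apply/subsetP => x; rewrite !in_fib => /andP[/(subsetP AB)-> ->]. Qed.

Lemma fill_fibres (X V : finType) (A B : {set X}) (k : X -> V) (n : V -> nat) :
  A \subset B -> (forall v, #|fib A k v| <= n v <= #|fib B k v|) ->
  exists S : {set X}, [/\ A \subset S, S \subset B & forall v, #|fib S k v| = n v].
Proof.
move=> AB nP; have /fin_all_exists[F FP] : forall v, exists S : {set X},
    [/\ fib A k v \subset S, S \subset fib B k v & #|S| = n v].
  by move=> v; apply: card_between (nP v); apply: fibS.
exists [set x | x \in F (k x)]; split => [||v].
- apply/subsetP => x xA; have [sF _ _] := FP (k x); rewrite inE; apply: (subsetP sF).
  by rewrite in_fib xA eqxx.
- apply/subsetP => x; rewrite inE; have [_ sF _] := FP (k x) => /(subsetP sF).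
  by rewrite in_fib => /andP[].
- have [_ sF <-] := FP v; apply: eq_card => x; rewrite in_fib inE.
  apply/andP/idP => [[xF /eqP <-] //|xF].
  by have := subsetP sF _ xF; rewrite in_fib => /andP[_ /eqP e]; rewrite e.
Qed.

Lemma fibU (X V : finType) (A B : {set X}) (k : X -> V) v :
  fib (A :|: B) k v = fib A k v :|: fib B k v.
Proof. by apply/setP => x; rewrite !inE andb_orl. Qed.

Lemma card_fibU (X V : finType) (A B : {set X}) (k : X -> V) v :
  [disjoint A & B] -> #|fib (A :|: B) k v| = #|fib A k v| + #|fib B k v|.
Proof.
move=> dAB; rewrite fibU cardsU disjoint_setI0 ?cards0 ?subn0 //.
by apply: disjointWl (disjointWr _ dAB); apply/subsetP => x; rewrite in_fib => /andP[].
Qed.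

Lemma card_fibD (X V : finType) (A B : {set X}) (k : X -> V) v :
  A \subset B -> #|fib (B :\: A) k v| = #|fib B k v| - #|fib A k v|.
Proof.
move=> AB; rewrite -[B in RHS](setID B A) (setIidPr AB) card_fibU ?addKn //.
by rewrite -setI_eq0 setIDA setDIl setDv set0I.
Qed.

Lemma disjoint_setUl (X : finType) (A B C : {set X}) :
  [disjoint A :|: B & C] = [disjoint A & C] && [disjoint B & C].
Proof. by rewrite -!setI_eq0 setIUl setU_eq0. Qed.

Lemma card_bigcup (I X : finType) (P : pred I) (F : I -> {set X}) :
  #|\bigcup_(i | P i) F i| <= \sum_(i | P i) #|F i|.
Proof.
elim/big_ind2: _ => [|m A k B h1 h2|//]; first by rewrite cards0.
by apply: leq_trans (leq_card_setU _ _) _; apply: leq_add.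
Qed.

(* T1 is corrected by a T-join inside T2. *)
Lemma even_connected (T : finType) (A : {set T}) (T1 T2 : {set T * T}) :
  [disjoint T1 & T2] -> (forall u, u \in T1 :|: T2 -> u.1 \in A /\ u.2 \notin A) ->
  (forall x y, connect (adjI T1 fst snd) x y) -> (forall x y, connect (adjI T2 fst snd) x y) ->
  exists U : {set T * T}, [/\ U \subset T1 :|: T2, forall x y, connect (adjI U fst snd) x y,
    forall v, ~~ odd #|fib U fst v| & forall v, ~~ odd #|fib U snd v|].
Proof.
move=> dT bip c1 c2; pose O := [set v | odd_at T1 fst snd v].
have [|J JT Jodd] := Tjoin (P := T2) (l := fst) (r := snd) (O := O).
  move=> x; rewrite (_ : [set y in O | _] = O); last by apply/setP => y; rewrite inE c2 andbT.
  rewrite odd_card_addb (eq_bigr (fun v => odd_at T1 fst snd v)) => [|v _]; last by rewrite inE.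
  have all_odd (k : T * T -> T) : \big[addb/false]_v odd #|fib T1 k v| = odd #|T1|.
    by rewrite (card_fibs T1 k) (big_morph odd oddD (erefl _)).
  by rewrite /odd_at big_split /= !all_odd addbb.
have TU : T1 \subset symdiff T1 J.
  apply/subsetP => u uT; rewrite inE uT; have [uJ|//] := boolP (u \in J).
  by have := subsetP JT _ uJ; rewrite (disjointFr dT uT).
exists (symdiff T1 J).
have sub : symdiff T1 J \subset T1 :|: T2.
  apply/subsetP => u; rewrite !inE; case: (u \in T1) => //= uJ; exact: (subsetP JT).
have e0 v : odd_at (symdiff T1 J) fst snd v = false.
  by rewrite odd_at_symdiff Jodd inE addbb.
(* All edges at a vertex have it as the same end, so [odd_at] is the parity of its degree. *)
have zero v : #|fib (symdiff T1 J) fst v| = 0 \/ #|fib (symdiff T1 J) snd v| = 0.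
  have [vA|vA] := boolP (v \in A); [right|left]; apply/eqP; rewrite cards_eq0 -subset0;
    apply/subsetP => u; rewrite in_fib => /andP[/(subsetP sub)/bip[u1 u2] /eqP e].
    by rewrite e vA in u2.
  by rewrite e (negPf vA) in u1.
split => // [x y|v|v].
- apply: connect_mono (c1 x y) => z w /exists_inP[u uT h]; apply/connect1/exists_inP.
  by exists u => //; apply: (subsetP TU).
- by have := e0 v; rewrite /odd_at; case: (zero v) => -> //=; rewrite ?addbF => ->.
- by have := e0 v; rewrite /odd_at; case: (zero v) => -> //=; rewrite ?addbF => ->.
Qed.

Lemma connected_incident (T : finType) (S : {set T * T}) x :
  1 < #|T| -> (forall x y, connect (adjI S fst snd) x y) ->
  exists2 u, u \in S & (u.1 == x) || (u.2 == x).
Proof.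
move=> T1 con; have [y yx] : exists y, y != x.
  move: T1; rewrite (cardD1 x) ltnS => /card_gt0P[y]; rewrite !inE andbT => yx.
  by exists y.
have /connectP[[|z p]] := con x y; first by move=> _ e; rewrite e eqxx in yx.
move=> /= /andP[/exists_inP[u uS] h _] _; exists u => //.
by case/orP: h => /andP[/eqP e1 /eqP e2]; apply/orP; [left|right]; apply/eqP.
Qed.

(** [d1] and [d2] are the degrees of [a] in the two unions of six connected sets. The additive
    constants 1 and 2 in the bounds come from rounding up in the groups of two and three edges. *)
Lemma skeleton (T : finType) (A : {set T}) (E : {set T * T}) :
  1 < #|T| -> (forall u, u \in E -> u.1 \in A /\ u.2 \notin A) -> tough 24 E ->
  (forall b, b \notin A -> 48 <= #|fib E snd b|) ->
  exists T0 U1 U2 R : {set T * T}, [/\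
    [/\ T0 \subset E, U1 \subset E, U2 \subset E & R \subset E],
    [/\ [disjoint T0 & U1], [disjoint T0 & U2], [disjoint U1 & U2] &
        [disjoint T0 :|: U1 :|: U2 & R]],
    [/\ forall x y, connect (adjI T0 fst snd) x y, forall x y, connect (adjI U1 fst snd) x y
      & forall x y, connect (adjI U2 fst snd) x y],
    [/\ forall v, ~~ odd #|fib U1 fst v|, forall v, ~~ odd #|fib U1 snd v|,
        forall v, ~~ odd #|fib U2 fst v| & forall v, ~~ odd #|fib U2 snd v|] &
    (forall b, b \notin A -> 8 <= #|fib R snd b|) /\
    (forall a, a \in A -> exists d1 d2, [/\ 6 <= d1, 6 <= d2, d1 + d2 <= #|fib E fst a|,
      2 * (#|fib T0 fst a| + #|fib U1 fst a|) <= d1 + 1 & 3 * #|fib U2 fst a| <= d2 + 2 /\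
      3 * #|fib R fst a| + #|fib T0 fst a| + #|fib U1 fst a| + #|fib U2 fst a| <=
        #|fib E fst a| + 2])].
Proof.
move=> T1 bip tE degb; have T0' : 0 < #|T| by apply: ltnW.
have [|S [SE Scon Sdis Sdeg]] := @thinning T E snd 24 2 12 isT T0' _ tE; first by [].
pose lo := [pred i : 'I_12 | i < 6].
have lo6 : #|lo| = 6 by rewrite -sum1_card big_mkcond /= !big_ord_recr big_ord0.
have hi6 : #|predC lo| = 6 by rewrite -sum1_card big_mkcond /= !big_ord_recr big_ord0.
pose H (P : pred 'I_12) := \bigcup_(i | P i) S i.
have HE P : H P \subset E by apply/bigcupsP.
have Hdis : [disjoint H lo & H (predC lo)].
  rewrite -setI_eq0; apply/eqP/setP => u; rewrite !inE; apply/negP.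
  move=> /andP[/bigcupP[i li ui] /bigcupP[j lj uj]].
  have ij : i != j by apply: contraTneq li => ->.
  by rewrite (disjointFr (Sdis i j ij) ui) in uj.
(* Each connected set has an edge at [a], and disjointness makes these edges distinct. *)
have Hdeg (P : pred 'I_12) a : a \in A -> #|P| <= #|fib (H P) fst a|.
  move=> aA; have /fin_all_exists[x xP] : forall i, exists u, u \in fib (S i) fst a.
    move=> i; have [u uS /orP[]] := connected_incident a T1 (Scon i); move/eqP=> ua.
      by exists u; rewrite in_fib uS ua eqxx.
    by have [_] := bip u (subsetP (SE i) _ uS); rewrite ua aA.
  have xinj : injective x.
    move=> i j e; apply/eqP/negPn/negP => ij; have := xP j; have := xP i.
    by rewrite e !in_fib => /andP[ui _] /andP[uj _]; rewrite (disjointFr (Sdis i j ij) ui) in uj.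
  rewrite -(card_imset _ xinj); apply/subset_leq_card/subsetP => _ /imsetP[i Pi ->].
  have := xP i; rewrite !in_fib => /andP[ui ->]; rewrite andbT; by apply/bigcupP; exists i.
have t1 : tough 6 (H lo) by have := tough_bigcup (P := lo) Scon Sdis; rewrite lo6.
have t2 : tough 6 (H (predC lo)) by have := tough_bigcup (P := predC lo) Scon Sdis; rewrite hi6.
have [|Q [QE Qcon Qdis Qdeg]] := @thinning T _ fst 6 2 3 isT T0' _ t1; first by [].
have [|Q' [QE' Qcon' Qdis' Qdeg']] := @thinning T _ fst 6 3 2 isT T0' _ t2; first by [].
pose i0 : 'I_3 := inord 0; pose i1 : 'I_3 := inord 1; pose i2 : 'I_3 := inord 2.
pose j0 : 'I_2 := inord 0; pose j1 : 'I_2 := inord 1.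
have [ne01 ne02 ne12] : [/\ i0 != i1, i0 != i2 & i1 != i2] by split; rewrite -val_eqE /= !inordK.
have nej : j0 != j1 by rewrite -val_eqE /= !inordK.
have bipQ u : u \in Q i1 :|: Q i2 -> u.1 \in A /\ u.2 \notin A.
  by move=> uQ; apply/bip/(subsetP (HE lo)); case/setUP: uQ; apply: (subsetP (QE _)).
have bipQ' u : u \in Q' j0 :|: Q' j1 -> u.1 \in A /\ u.2 \notin A.
  by move=> uQ; apply/bip/(subsetP (HE (predC lo))); case/setUP: uQ; apply: (subsetP (QE' _)).
have [U1 [U1s U1c U1a U1b]] := even_connected (Qdis _ _ ne12) bipQ (Qcon i1) (Qcon i2).
have [U2 [U2s U2c U2a U2b]] := even_connected (Qdis' _ _ nej) bipQ' (Qcon' j0) (Qcon' j1).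
have U1H : U1 \subset H lo by apply: subset_trans U1s _; rewrite subUset !QE.
have U2H : U2 \subset H (predC lo) by apply: subset_trans U2s _; rewrite subUset !QE'.
have d01 : [disjoint Q i0 & U1].
  apply: disjointWr U1s _; rewrite disjoint_sym disjoint_setUl.
  by rewrite !Qdis // eq_sym.
have d02 : [disjoint Q i0 & U2] by apply: disjointWl (QE i0) (disjointWr U2H Hdis).
have d12 : [disjoint U1 & U2] by apply: disjointWl U1H (disjointWr U2H Hdis).
pose K := Q i0 :|: U1 :|: U2.
have KH : K \subset H lo :|: H (predC lo).
  by apply: setUSS U2H; rewrite subUset QE.
have KE : K \subset E by apply: subset_trans KH _; rewrite subUset !HE.
have Kfib (k : T * T -> T) v : #|fib K k v| = #|fib (Q i0) k v| + #|fib U1 k v| + #|fib U2 k v|.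
  by rewrite card_fibU ?card_fibU // disjoint_setUl d02 d12.
(* At [b] the set [K] takes at most half of the edges, rounded up, so at least 24 = 8 * 3 remain. *)
have [|R [RE Rb Ra]] := @balanced_picks _ _ _ (E :\: K) snd fst (~: A) 3 8 isT.
  move=> b; rewrite inE => bA; rewrite card_fibD //.
  have : #|fib K snd b| <= (#|fib E snd b| + 1) %/ 2.
    apply: leq_trans (Sdeg b); apply: leq_trans (card_bigcup _ _).
    apply/subset_leq_card/subsetP => u; rewrite in_fib => /andP[/(subsetP KH) + ub].
    by case/setUP => /bigcupP[i _ ui]; apply/bigcupP; exists i; rewrite // in_fib ui.
  by have := degb b bA; clear; move: #|_| #|_| => x y; lia.
exists (Q i0), U1, U2, R; split; [split|split|by split|by split|split].
- exact: subset_trans (QE i0) (HE lo).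
- exact: subset_trans U1H (HE lo).
- exact: subset_trans U2H (HE _).
- exact: subset_trans RE (subsetDl _ _).
- by [].
- by [].
- by [].
- by rewrite -/K disjoint_sym; apply: disjointWl RE _; rewrite -setI_eq0 setIDAC setDIl setDv setI0.
- by move=> b bA; apply: Rb; rewrite inE.
- move=> a aA; exists #|fib (H lo) fst a|, #|fib (H (predC lo)) fst a|; split.
  + by have := Hdeg lo a aA; rewrite lo6.
  + by have := Hdeg (predC lo) a aA; rewrite hi6.
  + by rewrite -card_fibU //; apply/subset_leq_card/fibS; rewrite subUset !HE.
  + have : #|fib (Q i0) fst a| + #|fib U1 fst a| <= (#|fib (H lo) fst a| + 1) %/ 2.
      2: by clear; move: #|_| #|_| #|_| => x y z; lia.
    apply: leq_trans (Qdeg a); rewrite (bigD1 i0) //= (bigD1 i1) 1?eq_sym //= (bigD1 i2) /=; last first.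
      by rewrite eq_sym ne02 eq_sym ne12.
    rewrite leq_add2l addnA; apply: leq_trans (leq_addr _ _).
    apply: leq_trans (leq_card_setU _ _); rewrite -fibU; exact/subset_leq_card/fibS.
  + split.
      have : #|fib U2 fst a| <= (#|fib (H (predC lo)) fst a| + 2) %/ 3.
        2: by clear; move: #|_| #|_| => x y; lia.
      apply: leq_trans (Qdeg' a); rewrite (bigD1 j0) //= (bigD1 j1) 1?eq_sym //=.
      rewrite addnA; apply: leq_trans (leq_addr _ _).
      apply: leq_trans (leq_card_setU _ _); rewrite -fibU; exact/subset_leq_card/fibS.
    have := Ra a; rewrite card_fibD // Kfib.
    have : #|fib K fst a| <= #|fib E fst a| by apply/subset_leq_card/fibS.
    rewrite Kfib; clear; move: #|_| #|_| #|_| #|_| #|_| => x y z t w; lia.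
Qed.

(** * The partition and the colouring *)

(** By this the condition that [balanced_half] puts on every closed piece shrinks to a single one,
    on the whole of [U]. *)
Lemma closed_edges (T : finType) (A : {set T}) (U K : {set T * T}) :
  (forall u, u \in U -> u.1 \in A /\ u.2 \notin A) ->
  (forall x y, connect (adjI U fst snd) x y) -> K \subset U ->
  (forall x y, x \in K -> y \in U -> x.1 = y.1 \/ x.2 = y.2 -> y \in K) ->
  K = set0 \/ K = U.
Proof.
move=> bip con KU cl; have [->|/set0Pn[k0 k0K]] := eqVneq K set0; [by left|right].
apply/eqP; rewrite eqEsubset KU; apply/subsetP => y yU.
pose X := [set v | [exists k in K, (k.1 == v) || (k.2 == v)]].
have cross k u : k \in K -> u \in U -> k.1 != u.2 /\ k.2 != u.1.
  move=> /(subsetP KU)/bip[k1 k2] /bip[u1 u2]; split; apply/eqP => e.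
    by rewrite -e k1 in u2.
  by rewrite -e (negPf k2) in u1.
have share k u : k \in K -> u \in U -> (k.1 == u.1) || (k.2 == u.1) || (k.1 == u.2) || (k.2 == u.2) ->
    u \in K.
  move=> kK uU; have [/negPf-> /negPf->] := cross k u kK uU; rewrite !orbF => /orP e.
  by apply: (cl k u kK uU); case: e => /eqP; [left|right].
have inX u : u \in K -> u.1 \in X /\ u.2 \in X.
  by move=> uK; rewrite !inE; split; apply/exists_inP; exists u; rewrite ?eqxx ?orbT.
have Xcl : closed (adjI U fst snd) (mem X).
  apply: (intro_closed (connect_adjI_sym _ _ _)) => z w /exists_inP[u uU h].
  rewrite inE => /exists_inP[k kK kz].
  have uK : u \in K.
    apply: (share k) => //; case/orP: h => /andP[/eqP e1 /eqP e2]; rewrite ?e1 ?e2.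
      by case/orP: kz => ->; rewrite ?orbT.
    by case/orP: kz => ->; rewrite ?orbT.
  by have [u1 u2] := inX u uK; case/orP: h => /andP[/eqP e1 /eqP e2]; [rewrite -e2|rewrite -e1].
have : (k0.1 \in X) = (y.1 \in X) := closed_connect Xcl (con _ _).
have [-> _] := inX k0 k0K; move/esym; rewrite inE => /exists_inP[k kK ky].
by apply: (share k) => //; case/orP: ky => ->; rewrite ?orbT.
Qed.

Lemma odd_card_odd_fibs (X V : finType) (F : {set X}) (k : X -> V) :
  odd #|[set v | odd #|fib F k v|]| = odd #|F|.
Proof.
rewrite (card_fibs F k) (big_morph odd oddD (erefl _)) odd_card_addb.
by apply: eq_bigr => v _; rewrite inE.
Qed.

(** [balanced_half] is applied with [O] the set of vertices where [F] has odd degree. Since [#|O|]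
    and [#|F|] have the same parity, its condition on [U] is the evenness of [#|F| + #|U| %/ 2]. *)
Lemma half_with_parity (T : finType) (A : {set T}) (U F : {set T * T}) :
  1 < #|T| -> (forall u, u \in U -> u.1 \in A /\ u.2 \notin A) ->
  (forall u, u \in F -> u.2 \notin A) ->
  (forall x y, connect (adjI U fst snd) x y) ->
  (forall v, ~~ odd #|fib U fst v|) -> (forall v, ~~ odd #|fib U snd v|) ->
  ~~ odd (#|F| + #|U| %/ 2) ->
  exists W : {set T * T}, [/\ W \subset U, forall v, #|fib U fst v| = 2 * #|fib W fst v| &
    forall v, ~~ odd (#|fib F snd v| + #|fib W snd v|)].
Proof.
move=> T1 bip bipF con ea eb par; pose O := [set v | odd #|fib F snd v|].
have OU : O \subset snd @: U.
  apply/subsetP => v; rewrite inE => vo.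
  have vA : v \notin A.
    have [e|/set0Pn[u]] := eqVneq (fib F snd v) set0; first by rewrite e cards0 in vo.
    by rewrite in_fib => /andP[/bipF u2 /eqP <-].
  have [u uU /orP[] /eqP uv] := connected_incident v T1 con.
    by have [] := bip u uU; rewrite uv (negPf vA).
  by apply/imsetP; exists u.
have [|W [WU Wa Wb]] := balanced_half (O := O) ea eb OU.
  move=> K KU cl; have [->|->] := closed_edges bip con KU cl.
    by rewrite imset0 setI0 !cards0.
  rewrite (setIidPl OU) odd_card_odd_fibs; move: par; rewrite oddD.
  by case: (odd _); case: (odd _).
exists W; split => // v; rewrite oddD; have [-> _ _] := Wb v.
by rewrite inE addbb.
Qed.

(** [t], [2 * w1], [2 * w2] and [r] are the degrees in [T0], [U1], [U2] and [R]. The quotient [q] is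
    the largest [m] leaving room in L for [T0] and half of [U1]; as [d - 5 * m] and [d + m] have the
    same parity, subtracting [(d + q) %% 2] makes [l] even. The last two bounds give C room for [R]
    and the halves of [U1] and [U2], and Z room for half of [U2]. *)
Lemma class_sizes d d1 d2 t w1 w2 r :
  48 <= d -> 6 <= d1 -> 6 <= d2 -> d1 + d2 <= d -> 2 * (t + 2 * w1) <= d1 + 1 ->
  3 * (2 * w2) <= d2 + 2 -> 3 * r + t + 2 * w1 + 2 * w2 <= d + 2 ->
  exists l m, [/\ ~~ odd l, d = l + 5 * m, 2 <= m, t + w1 <= l & w1 + w2 + r <= 4 * m /\ w2 <= m].
Proof.
move=> h1 h2 h3 h4 h5 h6 h7; pose q := (d - (t + w1)) %/ 5.
pose m := q - (d + q) %% 2; exists (d - 5 * m), m.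
have q1 : 5 * q <= d - (t + w1) < 5 * q + 5 by rewrite /q; lia.
have m1 : q - 1 <= m <= q by rewrite /m; lia.
have q2 : 1 <= q by lia.
have m2 : (d + m) %% 2 = 0 by rewrite /m; lia.
split; [|lia..].
move: m1 m2 q1; clear; lia.
Qed.

(** [L0], [Z0] and [C0] are filled so that the sizes at A come out right whichever halves of [U1]
    and [U2] are added. Then [W1] goes to L and the rest of [U1] to C, and afterwards [W2] to C and
    the rest of [U2] to Z; in this order the second repair leaves L untouched. *)
Lemma classes (T : finType) (A : {set T}) (E : {set T * T}) :
  1 < #|T| -> (forall u, u \in E -> u.1 \in A /\ u.2 \notin A) -> tough 24 E ->
  (forall b, b \notin A -> 48 <= #|fib E snd b|) ->
  (forall a, a \in A -> 48 <= #|fib E fst a|) ->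
  exists (C Z L : {set T * T}) (m : T -> nat), [/\
    [/\ C :|: Z :|: L = E, [disjoint C & Z] & [disjoint C :|: Z & L]],
    forall v, [/\ #|fib C fst v| = 4 * m v, #|fib Z fst v| = m v & ~~ odd #|fib L fst v|],
    forall a, a \in A -> 2 <= m a,
    forall b, [/\ ~~ odd #|fib C snd b|, ~~ odd #|fib L snd b| &
      b \notin A -> 8 <= #|fib C snd b|] &
    forall x y, connect (adjI L fst snd) x y].
Proof.
move=> T1 bip tE degb dega.
have [T0 [U1 [U2 [R [[T0E U1E U2E RE] [d01 d02 d12 dR] [T0c U1c U2c] [U1a U1b U2a U2b]]]]]] :=
  skeleton T1 bip tE degb.
case=> Rb sizes.
pose w1 v := #|fib U1 fst v| %/ 2; pose w2 v := #|fib U2 fst v| %/ 2.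
have w1E v : #|fib U1 fst v| = 2 * w1 v by have := U1a v; rewrite /w1; lia.
have w2E v : #|fib U2 fst v| = 2 * w2 v by have := U2a v; rewrite /w2; lia.
have fib0 (F : {set T * T}) v : F \subset E -> v \notin A -> #|fib F fst v| = 0.
  move=> FE vA; apply/eqP; rewrite cards_eq0 -subset0; apply/subsetP => u.
  rewrite in_fib => /andP[/(subsetP FE)/bip[uA _] /eqP uv]; by rewrite uv (negPf vA) in uA.
have ex v : exists lm : nat * nat, [/\ ~~ odd lm.1, #|fib E fst v| = lm.1 + 5 * lm.2,
    v \in A -> 2 <= lm.2, #|fib T0 fst v| + w1 v <= lm.1 &
    w1 v + w2 v + #|fib R fst v| <= 4 * lm.2 /\ w2 v <= lm.2].
  have [vA|vA] := boolP (v \in A); last first.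
    by exists (0, 0); rewrite /w1 /w2 !fib0.
  have [d1 [d2 [h1 h2 h3 h4 [h5 h6]]]] := sizes v vA; rewrite w1E w2E in h4 h5 h6.
  by have [l [m [? ? ? ? ?]]] := class_sizes (dega v vA) h1 h2 h3 h4 h5 h6; exists (l, m).
have /fin_all_exists[lm lmP] := ex.
pose l v := (lm v).1; pose m v := (lm v).2.
have [d0R d1R d2R] : [/\ [disjoint T0 & R], [disjoint U1 & R] & [disjoint U2 & R]].
  by move: dR; rewrite !disjoint_setUl => /andP[/andP[-> ->] ->]; split.
have d0U : [disjoint T0 & U1 :|: U2 :|: R].
  by rewrite disjoint_sym !disjoint_setUl !(disjoint_sym _ T0) d01 d02 d0R.
have UR v : #|fib (U1 :|: U2 :|: R) fst v| = 2 * w1 v + 2 * w2 v + #|fib R fst v|.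
  by rewrite !card_fibU ?disjoint_setUl ?d12 ?d1R ?d2R // w1E w2E.
have URE : U1 :|: U2 :|: R \subset E by rewrite !subUset U1E U2E RE.
have [||L0 [T0L L0B L0n]] := @fill_fibres _ _ T0 (E :\: (U1 :|: U2 :|: R)) fst (fun v => l v - w1 v).
- by rewrite subsetD T0E d0U.
- move=> v; rewrite card_fibD // UR; have [_ e _ h1 [h2 h3]] := lmP v.
  rewrite e -/(l v) -/(m v) in h1 h2 h3 *; move: (l v) (m v) (w1 v) (w2 v) #|_| #|_| h1 h2 h3.
  by clear; lia.
have L0E : L0 \subset E by apply: subset_trans L0B (subsetDl _ _).
have L0d : [disjoint U1 :|: U2 :|: R & L0].
  by rewrite disjoint_sym; move: L0B; rewrite subsetD => /andP[].
have URL v : #|fib (U1 :|: U2 :|: R :|: L0) fst v| = w1 v + 2 * w2 v + #|fib R fst v| + l v.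
  rewrite card_fibU // UR L0n; have [_ _ _ h1 _] := lmP v; rewrite -/(l v) in h1.
  move: h1; move: (l v) (w1 v) (w2 v) #|_| #|_|; clear; lia.
have URLE : U1 :|: U2 :|: R :|: L0 \subset E by rewrite subUset URE.
have [||Z0 [_ Z0B Z0n]] := @fill_fibres _ _ set0 (E :\: (U1 :|: U2 :|: R :|: L0)) fst (fun v => m v - w2 v).
- exact: sub0set.
- move=> v; rewrite fib_set0 cards0 card_fibD // URL; have [_ e _ h1 [h2 h3]] := lmP v.
  rewrite e -/(l v) -/(m v) in h1 h2 h3 *; move: (l v) (m v) (w1 v) (w2 v) #|_| #|_| h1 h2 h3.
  by clear; lia.
have Z0E : Z0 \subset E by apply: subset_trans Z0B (subsetDl _ _).
have Z0d : [disjoint U1 :|: U2 :|: R :|: L0 & Z0].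
  by rewrite disjoint_sym; move: Z0B; rewrite subsetD => /andP[].
move: (L0d) (Z0d); rewrite !disjoint_setUl.
move=> /andP[/andP[d1L d2L] dRL] /andP[/andP[/andP[d1Z d2Z] dRZ] dLZ].
pose N := U1 :|: U2 :|: L0 :|: Z0.
have Nd : [&& [disjoint U1 & U2], [disjoint U1 :|: U2 & L0] & [disjoint U1 :|: U2 :|: L0 & Z0]].
  by rewrite !disjoint_setUl d12 d1L d2L d1Z d2Z dLZ.
have NE : N \subset E by rewrite !subUset U1E U2E L0E Z0E.
pose C0 := E :\: N.
have C0n v : #|fib C0 fst v| = 4 * m v - w1 v - w2 v.
  rewrite card_fibD // /N; case/and3P: Nd => n1 n2 n3; rewrite !card_fibU // w1E w2E L0n Z0n.
  have [_ e _ h1 [h2 h3]] := lmP v.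
  rewrite e -/(l v) -/(m v) in h1 h2 h3 *; move: (l v) (m v) (w1 v) (w2 v) #|_| #|_| h1 h2 h3.
  by clear; lia.
have RC0 : R \subset C0.
  rewrite subsetD RE disjoint_sym /N !disjoint_setUl d1R d2R.
  by rewrite disjoint_sym dRL disjoint_sym dRZ.
have bipS (F : {set T * T}) : F \subset E -> forall u, u \in F -> u.1 \in A /\ u.2 \notin A.
  by move=> FE u /(subsetP FE)/bip.
have half (U : {set T * T}) (w : T -> nat) : (forall v, #|fib U fst v| = 2 * w v) ->
    #|U| %/ 2 = \sum_v w v.
  move=> Uw; rewrite (card_fibs U fst) (eq_bigr (fun v => 2 * w v)) => [|v _]; last exact: Uw.
  by rewrite -big_distrr mulKn.
have even_sum (h : T -> nat) : (forall v, ~~ odd (h v)) -> ~~ odd (\sum_v h v).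
  move=> he; elim/big_ind: _ => //= x y; rewrite oddD; by case: (odd x); case: (odd y).
have [||W1 [W1U W1a W1b]] := half_with_parity T1 (bipS _ U1E) (F := L0) _ U1c U1a U1b.
- by move=> u /(bipS _ L0E)[].
(* The global parity is that of the sum of [(l v - w1 v) + w1 v = l v], all even. *)
- rewrite (half _ _ w1E) (card_fibs L0 fst) -big_split; apply: even_sum => v /=.
  rewrite L0n subnK; first by have [] := lmP v.
  have [_ _ _ h1 _] := lmP v; rewrite -/(l v) in h1; by apply: leq_trans h1; apply: leq_addl.
have W1n v : #|fib W1 fst v| = w1 v.
  by have := W1a v; rewrite w1E => /eqP; rewrite eqn_pmul2l // => /eqP.
pose C1 := C0 :|: (U1 :\: W1).
have U1N : U1 \subset N by rewrite /N -!setUA subsetUl.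
have U2N : U2 \subset N by rewrite /N -!setUA (subset_trans _ (subsetUr _ _)) ?subsetUl.
have C0U1 : [disjoint C0 & U1 :\: W1].
  apply: disjointWr (subsetDl _ _) _; apply: disjointWr U1N _.
  by rewrite -setI_eq0 setIDAC -setIDA setDv setI0.
have C1n v : #|fib C1 fst v| = 4 * m v - w2 v.
  rewrite card_fibU // card_fibD // C0n w1E W1n; have [_ _ _ _ [h2 h3]] := lmP v.
  rewrite -/(m v) in h2 h3; move: (m v) (w1 v) (w2 v) #|_| h2 h3; clear; lia.
have C1E : C1 \subset E by rewrite subUset subsetDl (subset_trans (subsetDl _ _)).
have [||W2 [W2U W2a W2b]] := half_with_parity T1 (bipS _ U2E) (F := C1) _ U2c U2a U2b.
- by move=> u /(bipS _ C1E)[].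
(* Here the summands are [(4 * m v - w2 v) + w2 v], again even. *)
- rewrite (half _ _ w2E) (card_fibs C1 fst) -big_split; apply: even_sum => v /=.
  rewrite C1n subnK; first by rewrite oddM.
  have [_ _ _ _ [_ h3]] := lmP v; rewrite -/(m v) in h3; apply: leq_trans h3 _.
  exact: leq_pmull.
have W2n v : #|fib W2 fst v| = w2 v.
  by have := W2a v; rewrite w2E => /eqP; rewrite eqn_pmul2l // => /eqP.
have dC1U2 : [disjoint C1 & U2].
  rewrite disjoint_setUl; apply/andP; split; last exact: disjointWl (subsetDl _ _) d12.
  apply: disjointWr U2N _; by rewrite -setI_eq0 setIDAC -setIDA setDv setI0.
have dZU : [disjoint Z0 & U2 :\: W2] by rewrite disjoint_sym; apply: disjointWl (subsetDl _ _) d2Z.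
have dLW : [disjoint L0 & W1] by rewrite disjoint_sym; apply: disjointWl W1U d1L.
have dC1W2 : [disjoint C1 & W2] := disjointWr W2U dC1U2.
exists (C1 :|: W2), (Z0 :|: (U2 :\: W2)), (L0 :|: W1), m; split.
- have booleans u : [&& (u \in W1) ==> (u \in U1), (u \in W2) ==> (u \in U2), (u \in U1) ==> (u \in E),
      (u \in U2) ==> (u \in E), (u \in L0) ==> (u \in E), (u \in Z0) ==> (u \in E),
      ~~ ((u \in U1) && (u \in U2)), ~~ ((u \in U1) && (u \in L0)), ~~ ((u \in U2) && (u \in L0)),
      ~~ ((u \in U1) && (u \in Z0)), ~~ ((u \in U2) && (u \in Z0)) & ~~ ((u \in L0) && (u \in Z0))].
    have sb (P Q : {set T * T}) : P \subset Q -> (u \in P) ==> (u \in Q).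
      by move=> PQ; apply/implyP/subsetP.
    have dj (P Q : {set T * T}) : [disjoint P & Q] -> ~~ ((u \in P) && (u \in Q)).
      by move=> PQ; apply/negP => /andP[uP]; rewrite (disjointFr PQ uP).
    by rewrite !sb // !dj.
  split; last 2 first.
  + rewrite -setI_eq0; apply/eqP/setP => u; move: (booleans u); rewrite !inE.
    by case: (u \in W1); case: (u \in W2); case: (u \in U1); case: (u \in U2);
      case: (u \in L0); case: (u \in Z0); case: (u \in E).
  + rewrite -setI_eq0; apply/eqP/setP => u; move: (booleans u); rewrite !inE.
    by case: (u \in W1); case: (u \in W2); case: (u \in U1); case: (u \in U2);
      case: (u \in L0); case: (u \in Z0); case: (u \in E).
  + apply/setP => u; move: (booleans u); rewrite !inE.
    by case: (u \in W1); case: (u \in W2); case: (u \in U1); case: (u \in U2);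
      case: (u \in L0); case: (u \in Z0); case: (u \in E).
- move=> v; split.
  + rewrite card_fibU // C1n W2n subnK //; have [_ _ _ _ [_ h3]] := lmP v; rewrite -/(m v) in h3.
    apply: leq_trans h3 _; exact: leq_pmull.
  + rewrite card_fibU // card_fibD // Z0n w2E W2n mul2n -addnn addnK subnK //.
    by have [_ _ _ _ [_ h3]] := lmP v.
  + rewrite card_fibU // L0n W1n subnK; first by have [] := lmP v.
    have [_ _ _ h1 _] := lmP v; rewrite -/(l v) in h1; by apply: leq_trans h1; apply: leq_addl.
- by move=> a aA; have [_ _ h _ _] := lmP a; apply: h.
- move=> b; split; [by rewrite card_fibU|by rewrite card_fibU|move=> bA].
  apply: leq_trans (Rb b bA) _; apply/subset_leq_card/fibS.
  apply: subset_trans RC0 _; by rewrite /C1 -setUA subsetUl.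
- move=> x y; apply: connect_mono (T0c x y) => z w /exists_inP[u uT h]; apply/connect1/exists_inP.
  by exists u => //; rewrite inE (subsetP T0L).
Qed.

Lemma pairing_colour (T V : finType) (D : {set T * T}) (k : T * T -> V) f (c : T * T -> nat)
    (s : nat -> nat) i j v :
  pairing D k f -> (forall x, x \in D -> c (f x) = s (c x)) -> s i = j -> s j = i ->
  #|fib (colour D c i) k v| = #|fib (colour D c j) k v|.
Proof.
move=> [ff _ fD kf] cf si sj; rewrite -(card_imset _ (inv_inj ff)); apply: eq_card => y.
rewrite in_fib inE; apply/imsetP/andP => [[x]|[/andP[yD /eqP cy] kv]].
  rewrite in_fib inE => /andP[/andP[xD /eqP cx] kv] ->; have [-> _] := fD x xD.
  by rewrite kf cf // cx si eqxx.
have [fyD _] := fD y yD; exists (f y); last by rewrite ff.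
by rewrite in_fib inE fyD cf // cy sj eqxx kf.
Qed.

Lemma card_fib_colourU (T V : finType) (P Q : {set T * T}) (k : T * T -> V) c i v :
  [disjoint P & Q] ->
  #|fib (colour (P :|: Q) c i) k v| = #|fib (colour P c i) k v| + #|fib (colour Q c i) k v|.
Proof.
move=> dPQ; rewrite -card_fibU; first by congr #|pred_of_set (fib _ k v)|; apply/setP => u; rewrite !inE andb_orl.
by apply: disjointWl (disjointWr _ dPQ); apply/subsetP => u; rewrite inE => /andP[].
Qed.

Lemma tour_of_connected (T : finType) (A : {set T}) (L : {set T * T}) :
  (forall u, u \in L -> u.1 \in A /\ u.2 \notin A) ->
  (forall v, ~~ odd #|fib L fst v|) -> (forall v, ~~ odd #|fib L snd v|) ->
  (forall x y, connect (adjI L fst snd) x y) -> 10 %| #|L| ->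
  exists c : T * T -> nat, [/\ forall u, u \in L -> 0 < c u <= 5,
    forall v, #|fib (colour L c 2) fst v| = #|fib (colour L c 3) fst v| /\
              #|fib (colour L c 4) fst v| = #|fib (colour L c 5) fst v| &
    forall v, #|fib (colour L c 1) snd v| = #|fib (colour L c 2) snd v| /\
              #|fib (colour L c 3) snd v| = #|fib (colour L c 4) snd v|].
Proof.
move=> bip ea eb con d10; have [f [g [pf pg st]]] := transitions_exist ea eb.
have [|c cP] := tour_coloring pf pg _ d10.
  move=> x y xL yL; pose K := [set z in L | connect (step2 f g) x z].
  have xK : x \in K by rewrite inE xL connect0.
  suff [K0|KL] : K = set0 \/ K = L.
  - by rewrite K0 inE in xK.
  - by move: yL; rewrite -KL inE => /andP[].
  apply: (closed_edges bip con) => [|z w]; first by apply/subsetP => z; rewrite inE => /andP[].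
  rewrite !inE => /andP[zL xz] wL zw; rewrite wL; apply: connect_trans xz _; exact: st.
have cf x : x \in L -> c (f x) = swA (c x) by case/cP.
have cg x : x \in L -> c (g x) = swB (c x) by case/cP.
exists c; split => [u /cP[]//|v|v]; split.
- exact: pairing_colour pf cf _ _.
- exact: pairing_colour pf cf _ _.
- exact: pairing_colour pg cg _ _.
- exact: pairing_colour pg cg _ _.
Qed.

(** The first halving, with [O] empty, has even halves at B, so that the second can be exact; its
    parity condition holds because a closed piece has a multiple of 4 edges. At a vertex of B both
    halves of at least 8 edges have at least 3, hence by parity at least 4, and every colour occurs
    twice or more: this is the origin of the 8. *)
Lemma four_colouring (T : finType) (A : {set T}) (C : {set T * T}) (m : T -> nat) :
  (forall u, u \in C -> u.1 \in A /\ u.2 \notin A) ->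
  (forall v, #|fib C fst v| = 4 * m v) ->
  (forall v, ~~ odd #|fib C snd v|) -> (forall v, v \notin A -> 8 <= #|fib C snd v|) ->
  exists c : T * T -> nat, [/\ forall u, u \in C -> 0 < c u <= 4,
    forall v i, 0 < i <= 4 -> #|fib (colour C c i) fst v| = m v,
    forall v, #|fib (colour C c 1) snd v| = #|fib (colour C c 2) snd v| /\
              #|fib (colour C c 3) snd v| = #|fib (colour C c 4) snd v| &
    forall v, v \notin A -> 2 <= #|fib (colour C c 2) snd v| /\ 2 <= #|fib (colour C c 3) snd v|].
Proof.
move=> bip ca eb b8.
have ea v : ~~ odd #|fib C fst v| by rewrite ca oddM.
have [|K KC clK|C1 [C1C C1a C1b]] := balanced_half (O := set0) ea eb.
- exact: sub0set.
- rewrite set0I cards0; apply/negbTE.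
  have [h ->] : exists h, #|K| = 4 * h.
    exists (\sum_v (if fib K fst v == set0 then 0 else m v)).
    rewrite (card_fibs K fst) big_distrr; apply: eq_bigr => v _ /=.
    have [->|/set0Pn[x]] := eqVneq (fib K fst v) set0; first by rewrite cards0.
    rewrite in_fib -ca => /andP[xK /eqP xv]; congr #|pred_of_set _|; apply/setP => y.
    rewrite !in_fib; apply: andb_id2r => /eqP yv; apply/idP/idP; first exact: (subsetP KC).
    by move=> yC; apply: (clK x) => //; left; rewrite xv yv.
  by rewrite -[4]/(2 * 2) -mulnA mulKn // oddM.
pose C2 := C :\: C1.
have C2n (k : T * T -> T) v : #|fib C2 k v| = #|fib C k v| - #|fib C1 k v| by apply: card_fibD.
have C1n v : #|fib C1 fst v| = 2 * m v by have := C1a v; rewrite ca; lia.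
have C2m v : #|fib C2 fst v| = 2 * m v by rewrite C2n ca C1n; lia.
have odd0 v : ~~ odd #|fib C1 snd v| by have [-> _ _] := C1b v; rewrite inE.
have C1le (k : T * T -> T) v : #|fib C1 k v| <= #|fib C k v| by apply/subset_leq_card/fibS.
have [||H1 [H1C H1a H1b]] := @exact_half _ _ _ C1 fst snd; [by move=> v; rewrite C1n oddM|exact: odd0|].
have [||H2 [H2C H2a H2b]] := @exact_half _ _ _ C2 fst snd.
- by move=> v; rewrite C2m oddM.
- by move=> v; rewrite C2n oddB // (negPf (eb v)) (negPf (odd0 v)).
pose c u := if u \in C1 then (if u \in H1 then 1 else 2) else (if u \in H2 then 3 else 4).
have c1 : colour C c 1 = H1.
  apply/setP => u; rewrite inE /c; have [uC1|uC1] := boolP (u \in C1).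
    by rewrite (subsetP C1C u uC1); case: (u \in H1).
  by rewrite (contraNF (subsetP H1C u) uC1); case: (u \in H2); rewrite andbF.
have c2 : colour C c 2 = C1 :\: H1.
  apply/setP => u; rewrite !inE /c; have [uC1|uC1] := boolP (u \in C1).
    by rewrite (subsetP C1C u uC1); case: (u \in H1).
  by case: (u \in H2); rewrite !andbF.
have H2C2 u : u \in H2 -> (u \in C) && (u \notin C1).
  by move=> /(subsetP H2C); rewrite inE andbC.
have c3 : colour C c 3 = H2.
  apply/setP => u; rewrite inE /c; have [uH|uH] := boolP (u \in H2).
    by have /andP[-> /negPf ->] := H2C2 u uH.
  by case: (u \in C1); case: (u \in H1); rewrite andbF.
have c4 : colour C c 4 = C2 :\: H2.
  apply/setP => u; rewrite !inE /c.
  by case: (u \in C1); case: (u \in H1); case: (u \in H2); rewrite ?andbF ?andbT.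
have H1h v : #|fib H1 fst v| = m v by have := H1a v; rewrite C1n; lia.
have H2h v : #|fib H2 fst v| = m v by have := H2a v; rewrite C2m; lia.
exists c; split => [u uC|v i|v|v vA].
- by rewrite /c; case: (u \in C1); case: (u \in H1); case: (u \in H2).
- case: i => [|[|[|[|[|i]]]]] // _; rewrite ?c1 ?c2 ?c3 ?c4 ?card_fibD // ?C1n ?C2m ?H1h ?H2h //.
    by clear; lia.
  by rewrite ca; clear; lia.
- rewrite c1 c2 c3 c4 (card_fibD snd v H1C) (card_fibD snd v H2C) H1b H2b.
  by rewrite !mul2n -!addnn !addnK.
- rewrite c2 c3 card_fibD //; have := H1b v; have := H2b v; rewrite C2n.
  have := b8 v vA; have := odd0 v; have := eb v; have := C1le snd v; have [_ + +] := C1b v.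
  move: #|fib C1 snd v| #|fib C snd v| #|fib H1 snd v| #|fib H2 snd v|; clear => *; lia.
Qed.

Lemma colouring_of_classes (T : finType) (A : {set T}) (E : {set T * T}) :
  1 < #|T| -> (forall u, u \in E -> u.1 \in A /\ u.2 \notin A) -> tough 24 E ->
  (forall b, b \notin A -> 48 <= #|fib E snd b|) ->
  (forall a, a \in A -> 48 <= #|fib E fst a|) -> 5 %| #|E| ->
  exists c : T * T -> nat, let C := colour E c in [/\
  forall u, u \in E -> 0 < c u <= 5,
  forall v, #|fib (C 2) fst v| = #|fib (C 3) fst v| /\ #|fib (C 3) fst v| != 1,
  forall v, #|fib (C 4) fst v| = #|fib (C 5) fst v| /\ #|fib (C 4) fst v| != 1,
  forall v, #|fib (C 1) snd v| = #|fib (C 2) snd v| /\ #|fib (C 2) snd v| != 1 &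
  forall v, #|fib (C 3) snd v| = #|fib (C 4) snd v| /\ #|fib (C 3) snd v| != 1].
Proof.
move=> T1 bip tE degb dega d5.
have [C [Z [L [m [[eE dCZ dL] cnt m2 bcnt Lcon]]]]] := classes T1 bip tE degb dega.
have CE : C \subset E by rewrite -eE -setUA subsetUl.
have LE : L \subset E by rewrite -eE subsetUr.
have [||||cC [cC4 cCa cCb cCb2]] := @four_colouring T A C m.
- by move=> u /(subsetP CE)/bip.
- by move=> v; have [] := cnt v.
- by move=> v; have [] := bcnt v.
- by move=> v vA; have [_ _ ->] := bcnt v.
have evL v : ~~ odd #|fib L fst v| by have [] := cnt v.
(* C and Z together have [5 * m v] edges at [v], which transfers divisibility by 5 from [E];
   divisibility by 2 comes from the even degrees at A. *)
have L10 : 10 %| #|L|.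
  have e : #|E| = 5 * \sum_v m v + #|L|.
    rewrite (card_fibs E fst) (card_fibs L fst) big_distrr -big_split; apply: eq_bigr => v _ /=.
    by rewrite -eE !card_fibU //; have [-> -> _] := cnt v; rewrite -mulSnr.
  have d5L : 5 %| #|L| by rewrite -(dvdn_addr _ (dvdn_mulr (\sum_v m v) (dvdnn 5))) -e.
  have d2L : 2 %| #|L|.
    rewrite (card_fibs L fst); apply: dvdn_sum => v _; by rewrite dvdn2 evL.
  by rewrite -[10]/(2 * 5) Gauss_dvd // d2L.
have [|||||cL [cL5 cLa cLb]] := @tour_of_connected T A L.
- by move=> u /(subsetP LE)/bip.
- exact: evL.
- by move=> v; have [] := bcnt v.
- exact: Lcon.
- exact: L10.
(* At A the [m v] edges of [Z], coloured 5, balance the [m v] edges of [C] coloured 4. *)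
pose c u := if u \in Z then 5 else if u \in L then cL u else cC u.
have CP u : u \in C -> u \notin Z /\ u \notin L.
  by move=> uC; rewrite (disjointFr dCZ uC) (disjointFr dL) // inE uC.
have LP u : u \in L -> u \notin Z.
  by move=> uL; have := disjointFl dL uL; rewrite inE => /norP[].
have eC i : colour C c i = colour C cC i.
  apply/setP => u; rewrite !inE; apply: andb_id2l => /CP[/negPf uZ /negPf uL].
  by rewrite /c uZ uL.
have eL i : colour L c i = colour L cL i.
  apply/setP => u; rewrite !inE; apply: andb_id2l => uL.
  by rewrite /c (negPf (LP u uL)) uL.
have eZ i : colour Z c i = if i == 5 then Z else set0.
  apply/setP => u; rewrite inE /c; have [uZ|uZ] := boolP (u \in Z); rewrite eq_sym.
    by case: ifP => _; rewrite ?inE.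
  by rewrite andFb; case: ifP => _; rewrite ?inE ?(negPf uZ).
have C5 : colour C cC 5 = set0.
  apply/setP => u; rewrite !inE; apply/negbTE/negP => /andP[/cC4 + /eqP e]; by rewrite e.
have split3 i k v : #|fib (colour E c i) k v| = #|fib (colour C cC i) k v| +
    #|fib (if i == 5 then Z else set0) k v| + #|fib (colour L cL i) k v|.
  by rewrite -eE !card_fib_colourU // eC eL eZ.
have fst1 i v : (v \in A -> 2 <= #|fib (colour E c i) fst v|) -> #|fib (colour E c i) fst v| != 1.
  have [vA /(_ isT)|vA _] := boolP (v \in A); first by case: #|_| => [|[|]].
  rewrite (_ : fib _ _ _ = set0) ?cards0 //; apply/setP => u; rewrite in_fib inE in_set0.
  apply/negbTE/negP => /andP[/andP[/bip[uA _] _] /eqP uv]; by rewrite uv (negPf vA) in uA.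
have snd1 i v : (v \notin A -> 2 <= #|fib (colour E c i) snd v|) -> #|fib (colour E c i) snd v| != 1.
  have [vA _|vA /(_ isT)] := boolP (v \in A); last by case: #|_| => [|[|]].
  rewrite (_ : fib _ _ _ = set0) ?cards0 //; apply/setP => u; rewrite in_fib inE in_set0.
  apply/negbTE/negP => /andP[/andP[/bip[_ uA] _] /eqP uv]; by rewrite uv vA in uA.
have Zm v : #|fib Z fst v| = m v by have [] := cnt v.
exists c; split => [u uE|v|v|v|v].
- rewrite /c; have [//|uZ] := boolP (u \in Z); have [/cL5 //|uL] := boolP (u \in L).
  have /cC4 : u \in C by move: uE; rewrite -eE !inE (negPf uZ) (negPf uL) !orbF.
  by case/andP => -> /leq_trans ->.
- split; last by apply: fst1 => vA; rewrite split3 cCa // -addnA; apply: leq_trans (m2 v vA) (leq_addr _ _).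
  by rewrite !split3 /= !cCa // (cLa v).1.
- split; last by apply: fst1 => vA; rewrite split3 cCa // -addnA; apply: leq_trans (m2 v vA) (leq_addr _ _).
  by rewrite !split3 /= !fib_set0 cards0 cCa // C5 fib_set0 cards0 Zm (cLa v).2 addn0.
- split; last first.
    by apply: snd1 => vA; rewrite split3 -addnA; apply: leq_trans (cCb2 v vA).1 (leq_addr _ _).
  by rewrite !split3 /= (cCb v).1 (cLb v).1.
- split; last first.
    by apply: snd1 => vA; rewrite split3 -addnA; apply: leq_trans (cCb2 v vA).2 (leq_addr _ _).
  by rewrite !split3 /= (cCb v).2 (cLb v).2.
Qed.

Lemma edges_arcs (T : finType) (e : rel T) (A : {set T}) :
  symmetric e -> (forall x y, e x y -> (x \in A) != (y \in A)) ->
  edges e = [set [set u.1; u.2] | u in arcs e A].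
Proof.
move=> es eb; apply/setP => X; apply/imsetP/imsetP => -[u].
  rewrite inE => eu ->; have := eb _ _ eu; case uA: (u.1 \in A) => vA.
    by exists u; rewrite // inE eu uA.
  exists (u.2, u.1); last by rewrite setUC.
  rewrite inE /= es eu.
  by move: vA; case: (u.2 \in A).
by rewrite inE => /andP[eu _] ->; exists u; rewrite ?inE.
Qed.

Theorem mainTheorem7 (T : finType) (e : rel T) :
  symmetric e -> irreflexive e ->
  edge_connected 48 e -> bipartite e -> 5 %| #|edges e| ->
  path_decomposition 5 e.
Proof.
move=> es ei ec [A eb] d5; have [T1|T1] := leqP #|T| 1.
  have e0 : edges e = set0.
    apply/setP => X; rewrite inE; apply/imsetP => -[u + _]; rewrite inE.
    by rewrite (card_le1_eqP T1 u.1 u.2) // ei.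
  exists set0; split=> [|B]; last by rewrite inE.
  by rewrite e0; apply/and3P; split; rewrite ?/cover ?/trivIset ?/cover ?big_set0 ?cards0 ?inE.
have bip u : u \in arcs e A -> u.1 \in A /\ u.2 \notin A.
  by rewrite inE => /andP[/eb + uA]; rewrite uA; case: (u.2 \in A).
have other (x : T) : exists y, y != x.
  by move: T1; rewrite (cardD1 x) ltnS => /card_gt0P[y]; rewrite !inE andbT => yx; exists y.
have deg x : 48 <= #|cut (arcs e A) [set x]|.
  have [y yx] := other x; by apply: (cut_lower (x := x) (y := y) es eb ec); rewrite inE.
(* Toughness 24 is [card_outside_rank] for 48 divided by 2; the degree bounds are the cuts around
   single vertices. *)
have [|b bA|a aA||c [c5 ca1 ca2 cb1 cb2]] := colouring_of_classes T1 bip.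
- move=> Y YE; have := card_outside_rank es eb ec YE; clear; lia.
- apply: leq_trans (deg b) _; apply/subset_leq_card/subsetP => u; rewrite inE in_fib.
  case/andP => uE; rewrite uE !inE; have [u1 _] := bip u uE.
  have /negPf-> : u.1 != b by apply: contraNneq bA => <-.
  by case: (u.2 == b).
- apply: leq_trans (deg a) _; apply/subset_leq_card/subsetP => u; rewrite inE in_fib.
  case/andP => uE; rewrite uE !inE; have [_ u2] := bip u uE.
  have /negPf-> : u.2 != a by apply: contraTneq aA => <-.
  by case: (u.1 == a).
- rewrite (edges_arcs es eb) card_in_imset in d5; first exact: d5.
  by move=> u v /bip[? ?] /bip[? ?]; apply: (edge_inj (A := A)).
exact: (path_decomposition_of_colouring es eb c5).
Qed.
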